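(* Let $m \ge 1$ and $p \ge 1$ be integers. The generic sub-class of the ARMA$(p,p)$-irreducible parametrization, i.e. the set of all $m$-output linear systems whose Kronecker indices satisfy $n_1 = n_2 = \dots = n_m = p$, is a differentiable manifold of dimension $2pm^2$, where $m$ is the number of components of $\{y_t\}$.
   Context: A linear system (with $m$ inputs and $m$ outputs) is identified with its sequence $\{H_i\}_{i\ge 0}$ of real $m\times m$ Markov parameters, or equivalently its transfer function $H(z)=\sum_{i\ge 0} H_i z^{-i}$, which is a rational matrix. Here $H_0 = I$, and the system is stable (all poles in the open unit disc). Systems are points of the Hilbert space of square-summable sequences of $m\times m$ matrices with inner product $\langle s_1,s_2\rangle = \mathrm{tr}\big[\sum_{i\ge 0} H_i^{(1)}(H_i^{(2)})^T\big]$, and sets of systems are regarded as subsets of this space. Kronecker indices: let $\mathcal{H}$ be the infinite block Hankel matrix whose $(i,j)$ block ($i,j\ge 1$) is $H_{i+j-1}$. Scan the rows of $\mathcal H$ from top to bottom, retaining a row if and only if it is linearly independent of the preceding rows. The Kronecker index $n_i$ ($i=1,\dots,m$) is the number of retained rows that are the $i$-th row of some block row (i.e. correspond to the $i$-th component of $y$). ARMA$(p,p)$-irreducible parametrization: the models $y_t + A_1 y_{t-1} + \dots + A_p y_{t-p} = \varepsilon_t + B_1\varepsilon_{t-1} + \dots + B_p \varepsilon_{t-p}$ with $m\times m$ real matrices $A_i,B_i$ (all in principle full), where $p$ cannot be reduced. They represent exactly the systems with $\max_i n_i = p$. The transfer function of such a model is $H(z)=A(z)^{-1}B(z)$ with $A(z)=I+A_1z^{-1}+\dots+A_pz^{-p}$,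 $B(z)=I+B_1z^{-1}+\dots+B_pz^{-p}$. The generic sub-class is the case in which all the matrices are full and $\mathrm{rank}[A_p,B_p]=m$, which is the case of systems with $n_1=\dots=n_m=p$. *)

(* Defs.v *)
From HB Require Import structures.
From mathcomp Require Import all_boot all_order all_algebra.
From mathcomp Require Import complex ring lra.
From mathcomp Require Import all_classical all_reals all_analysis.

Set Implicit Arguments.
Unset Strict Implicit.
Unset Printing Implicit Defensive.

Import Order.TTheory GRing.Theory Num.Theory.
Import numFieldNormedType.Exports.

Local Open Scope classical_set_scope.
Local Open Scope ring_scope.

(** * The Hilbert space of square-summable sequences of matrices *)

Section mxdot.
Variables (R : realType) (m : nat).
Implicit Types a b c : 'M[R]_m.

Definition mxdot a b : R := \tr (a *m b^T).

Lemma mxdotE a b : mxdot a b = \sum_i \sum_j a i j * b i j.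
Proof.
rewrite /mxdot /mxtrace; apply: eq_bigr => i _; rewrite !mxE.
by apply: eq_bigr => j _; rewrite mxE.
Qed.

Lemma mxdotC a b : mxdot a b = mxdot b a.
Proof. by rewrite /mxdot -mxtrace_tr trmx_mul trmxK. Qed.

Lemma mxdotDl a b c : mxdot (a + b) c = mxdot a c + mxdot b c.
Proof. by rewrite /mxdot mulmxDl raddfD. Qed.

Lemma mxdotDr a b c : mxdot a (b + c) = mxdot a b + mxdot a c.
Proof. by rewrite mxdotC mxdotDl !(mxdotC a). Qed.

Lemma mxdotZl k a b : mxdot (k *: a) b = k * mxdot a b.
Proof. by rewrite /mxdot -scalemxAl mxtraceZ. Qed.

Lemma mxdotZr k a b : mxdot a (k *: b) = k * mxdot a b.
Proof. by rewrite mxdotC mxdotZl mxdotC. Qed.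

Lemma mxdot_ge0 a : 0 <= mxdot a a.
Proof.
by rewrite mxdotE; do 2![apply: sumr_ge0 => ? _]; rewrite -expr2 sqr_ge0.
Qed.

Lemma mxdot_eq0 a : mxdot a a = 0 -> a = 0.
Proof.
rewrite mxdotE => /eqP a0; apply/matrixP => i j; rewrite mxE.
move: a0; rewrite psumr_eq0 => [/allP /(_ i (mem_index_enum _)) /=|k _]; last first.
  by apply: sumr_ge0 => ? _; rewrite -expr2 sqr_ge0.
rewrite psumr_eq0 => [/allP /(_ j (mem_index_enum _)) /=|k _]; last first.
  by rewrite -expr2 sqr_ge0.
by rewrite mulf_eq0 orbb => /eqP.
Qed.

Lemma mxdot_norm_le a b : `|mxdot a b| <= mxdot a a + mxdot b b.
Proof.
have p := mxdot_ge0 (a + b).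
have q := mxdot_ge0 (a + (- 1) *: b).
move: p q; rewrite !(mxdotDl, mxdotDr, mxdotZl, mxdotZr) (mxdotC b a).
have := mxdot_ge0 a; have := mxdot_ge0 b.
move: (mxdot a a) (mxdot a b) (mxdot b b) => x y z.
by move=> *; rewrite ler_norml; lra.
Qed.

End mxdot.

Section sqsum.
Variables (R : realType) (m : nat).
Local Notation mseq := (nat -> 'M[R]_m).

Definition dot_series (s t : mseq) : R^nat :=
  series (fun i => mxdot (s i) (t i)).

Lemma dot_seriesC s t : dot_series s t = dot_series t s.
Proof. by congr series; apply/funext => i; rewrite mxdotC. Qed.

Lemma dot_seriesDl s t u :
  dot_series (s + t) u = dot_series s u + dot_series t u.
Proof.
rewrite /dot_series -seriesD; congr series.
by apply/funext => i; rewrite [LHS]mxdotDl.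
Qed.

Lemma dot_seriesZl k s t : dot_series (k *: s) t = k *: dot_series s t.
Proof.
rewrite /dot_series -seriesZ; congr series.
by apply/funext => i; rewrite [LHS]mxdotZl.
Qed.

Definition sqsum : {pred mseq} := fun s => `[< cvgn (dot_series s s) >].

Lemma sqsum_cvg_dot s t : s \in sqsum -> t \in sqsum -> cvgn (dot_series s t).
Proof.
move=> /asboolP cs /asboolP ct; apply: normed_cvg.
apply: (@series_le_cvg R _ (fun i => mxdot (s i) (s i) + mxdot (t i) (t i))).
- by move=> i /=.
- by move=> i; rewrite addr_ge0 ?mxdot_ge0.
- by move=> i; exact: mxdot_norm_le.
- have -> : series (fun i => mxdot (s i) (s i) + mxdot (t i) (t i)) =
      dot_series s s + dot_series t t.
    by rewrite /dot_series seriesD.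
  exact: is_cvgD.
Qed.

Lemma sqsum_submod : submod_closed sqsum.
Proof.
split.
  apply/asboolP; have -> : dot_series (0 : mseq) 0 = fun=> 0.
    apply/funext => n; rewrite /dot_series /series /= big1 // => i _.
    by rewrite /mxdot mul0mx mxtrace0.
  exact: is_cvg_cst.
move=> k s t hs ht; apply/asboolP.
rewrite dot_seriesDl dot_seriesZl ![dot_series _ (_ + _)]dot_seriesC.
rewrite !dot_seriesDl !dot_seriesZl (dot_seriesC t s) scalerDr -addrA.
apply: is_cvgD; first by do 2!apply: is_cvgZr; exact/asboolP.
apply: is_cvgD; first by apply: is_cvgZr; exact: sqsum_cvg_dot.
apply: is_cvgD; last exact/asboolP.
by apply: is_cvgZr; exact: sqsum_cvg_dot.
Qed.

End sqsum.

HB.instance Definition _ (R : realType) (m : nat) :=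
  GRing.isSubmodClosed.Build R (nat -> 'M[R]_m) (@sqsum R m) (@sqsum_submod R m).

Record l2mx (R : realType) (m : nat) : Type := L2mx {
  l2val :> nat -> 'M[R]_m ;
  _ : l2val \in @sqsum R m }.

HB.instance Definition _ (R : realType) (m : nat) :=
  [isSub for @l2val R m].
HB.instance Definition _ (R : realType) (m : nat) :=
  [Choice of l2mx R m by <:].
HB.instance Definition _ (R : realType) (m : nat) :=
  [SubChoice_isSubLmodule of l2mx R m by <:].

Section l2norm.
Variables (R : realType) (m : nat).
Implicit Types s t u : l2mx R m.

(* [\sum_i tr (s_i t_i^T) = tr (\sum_i s_i t_i^T)] *)
Definition l2dot s t : R := limn (dot_series s t).

Definition l2norm s : R := Num.sqrt (l2dot s s).

Lemma is_cvg_l2dot s t : cvgn (dot_series s t).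
Proof. by apply: sqsum_cvg_dot; exact: valP. Qed.

Lemma l2dotC s t : l2dot s t = l2dot t s.
Proof. by rewrite /l2dot dot_seriesC. Qed.

Lemma l2dotDl s t u : l2dot (s + t) u = l2dot s u + l2dot t u.
Proof.
rewrite /l2dot -limD; [|exact: is_cvg_l2dot..].
by congr (limn _); exact: dot_seriesDl.
Qed.

Lemma l2dotZl k s t : l2dot (k *: s) t = k * l2dot s t.
Proof.
rewrite /l2dot -[RHS]limZr; [|exact: is_cvg_l2dot].
by congr (limn _); exact: dot_seriesZl.
Qed.

Lemma dot_series_nd s : nondecreasing_seq (dot_series s s).
Proof.
apply/nondecreasing_seqP => n; rewrite /dot_series /series /= big_nat_recr //=.
by rewrite lerDl mxdot_ge0.
Qed.

Lemma mxdot_le_l2dot s i : mxdot (s i) (s i) <= l2dot s s.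
Proof.
have := nondecreasing_cvgn_le (@dot_series_nd s) (@is_cvg_l2dot s s) i.+1.
apply: le_trans; rewrite /dot_series /series /= big_nat_recr //= lerDr.
by apply: sumr_ge0 => ? _; exact: mxdot_ge0.
Qed.

Lemma l2dot_ge0 s : 0 <= l2dot s s.
Proof. exact: le_trans (mxdot_ge0 _) (mxdot_le_l2dot s 0). Qed.

Lemma l2dot_CS s t : l2dot s t ^+ 2 <= l2dot s s * l2dot t t.
Proof.
have P k : 0 <= l2dot s s + 2 * k * l2dot s t + k ^+ 2 * l2dot t t.
  have := l2dot_ge0 (s + k *: t).
  rewrite !(l2dotDl, l2dotZl) ![l2dot _ (s + _)]l2dotC !(l2dotDl, l2dotZl).
  by rewrite (l2dotC t s); congr (0 <= _); ring.
have := l2dot_ge0 t; rewrite le_eqVlt => /orP[/eqP t0|t0].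
  rewrite -t0 mulr0; have [->|b0] := eqVneq (l2dot s t) 0; first by rewrite expr0n.
  have := P (- (l2dot s s + 1) / (2 * l2dot s t)); rewrite -t0 mulr0 addr0.
  have -> : 2 * (- (l2dot s s + 1) / (2 * l2dot s t)) * l2dot s t =
    - (l2dot s s + 1) by field.
  lra.
have := P (- l2dot s t / l2dot t t).
have -> : l2dot s s + 2 * (- l2dot s t / l2dot t t) * l2dot s t +
    (- l2dot s t / l2dot t t) ^+ 2 * l2dot t t =
    (l2dot s s * l2dot t t - l2dot s t ^+ 2) / l2dot t t.
  by field; rewrite gt_eqF.
by rewrite pmulr_lge0 ?invr_gt0// subr_ge0.
Qed.

Lemma ler_l2normD s t : l2norm (s + t) <= l2norm s + l2norm t.
Proof.
have n0 u : 0 <= l2norm u by exact: sqrtr_ge0.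
have nE u : l2norm u ^+ 2 = l2dot u u by rewrite sqr_sqrtr ?l2dot_ge0.
have st : l2dot s t <= l2norm s * l2norm t.
  rewrite (le_trans (ler_norm _))// -(ler_pXn2r (ltn0Sn 1)) ?nnegrE ?mulr_ge0//.
  by rewrite real_normK ?num_real// exprMn !nE l2dot_CS.
rewrite -(ler_pXn2r (ltn0Sn 1)) ?nnegrE ?addr_ge0// sqrrD !nE.
rewrite !l2dotDl ![l2dot _ (s + t)]l2dotC !l2dotDl (l2dotC t s).
lra.
Qed.

Lemma l2normZ (k : R) s : l2norm (k *: s) = `|k| * l2norm s.
Proof.
rewrite /l2norm l2dotZl l2dotC l2dotZl mulrA -expr2 sqrtrM ?sqr_ge0//.
by rewrite sqrtr_sqr.
Qed.

Lemma l2norm_eq0 s : l2norm s = 0 -> s = 0.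
Proof.
move=> /eqP; rewrite sqrtr_eq0 => s0; apply: val_inj; apply/funext => i /=.
apply: mxdot_eq0; apply/eqP; rewrite eq_le mxdot_ge0 andbT.
exact: le_trans (mxdot_le_l2dot s i) s0.
Qed.

End l2norm.

HB.instance Definition _ (R : realType) (m : nat) :=
  @Lmodule_isNormed.Build R (l2mx R m) (@l2norm R m)
    (@ler_l2normD R m) (@l2normZ R m) (@l2norm_eq0 R m).

(** * Differentiable manifolds in a normed space *)

(* For finite-dimensional [V] and open [U], this is the usual class C^k: all
   iterated directional derivatives of order at most [k] exist and are
   continuous on [U]. *)
Fixpoint Ck_on (R : realType) (V W : normedModType R) (k : nat)
    (U : set V) (f : V -> W) : Prop :=
  (forall x, U x -> {for x, continuous f}) /\
  if k is k'.+1 then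
    forall v, (forall x, U x -> derivable f x v) /\
              Ck_on k' U (fun x => 'D_v f x)
  else True.

Definition smooth_on (R : realType) (V W : normedModType R)
  (U : set V) (f : V -> W) : Prop := forall k, Ck_on k U f.

Section manifold.
Variables (R : realType) (E : normedModType R) (d : nat).

(* A chart is the bijection [chart_coord] of [chart_param @` chart_domain] onto
   [chart_domain], with inverse [chart_param]; values outside these sets are irrelevant. *)
Record chart := Chart {
  chart_domain : set 'rV[R]_d ;
  chart_param : 'rV[R]_d -> E ;
  chart_coord : E -> 'rV[R]_d }.

(* A homeomorphism between a relatively open subset of [M] and an open subset
   of R^d. *)
Definition is_chart (M : set E) (c : chart) : Prop :=
  [/\ open (chart_domain c),
      exists2 W : set E, open W & chart_param c @` chart_domain c = M `&` W,
      forall x, chart_domain c x -> chart_coord c (chart_param c x) = x,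
      {within chart_domain c, continuous (chart_param c)} &
      {within chart_param c @` chart_domain c, continuous (chart_coord c)}].

Definition transition_smooth (c1 c2 : chart) : Prop :=
  smooth_on
    [set x | chart_domain c1 x /\
             (chart_param c2 @` chart_domain c2) (chart_param c1 x)]
    (chart_coord c2 \o chart_param c1).

Definition immersed (c : chart) : Prop :=
  smooth_on (chart_domain c) (chart_param c) /\
  forall x v, chart_domain c x -> 'D_v (chart_param c) x = 0 -> v = 0.

(* [M] carries the topology induced by [E], hence is Hausdorff, and second
   countable when [E] is separable; its differentiable structure is the one
   for which the inclusion in [E] is an immersion. *)
Definition differentiable_manifold (M : set E) : Prop :=
  exists A : set chart,
    [/\ forall c, A c -> is_chart M c,
        forall s, M s -> exists2 c, A c & (chart_param c @` chart_domain c) s,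
        forall c1 c2, A c1 -> A c2 -> transition_smooth c1 c2 &
        forall c, A c -> immersed c].

End manifold.

(** * Linear systems *)

Section systems.
Variables (R : realType) (m : nat).
Implicit Type H : nat -> 'M[R]_m.

(* [den(z) * \sum_i H_i(a, b) z^-i = num(z)], as an identity between Laurent
   series in [z^-1]: the second condition compares the coefficients of [z^j]
   for [j >= 0], the third one those of [z^-(i+1)]. *)
Definition entry_fraction H (a b : 'I_m) (num den : {poly R}) : Prop :=
  [/\ den != 0,
      forall j : nat,
        num`_j = \sum_(j <= k < size den) den`_k * H (k - j)%N a b &
      forall i : nat, \sum_(k < size den) den`_k * H (k + i.+1)%N a b = 0].

Definition rational_transfer H : Prop :=
  forall a b, exists num den, entry_fraction H a b num den.

(* The poles of the transfer function are those of its entries, i.e. the zeros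
   of their denominators in lowest terms. *)
Definition pole H (z : R[i]) : Prop :=
  exists a b num den, [/\ entry_fraction H a b num den, coprimep num den &
    root (map_poly (real_complex R) den) z].

Definition linear_system H : Prop :=
  [/\ H 0%N = 1%:M, rational_transfer H & forall z, pole H z -> `|z| < 1].

(* Block rows and columns are numbered from 0, so that the block in position
   [(i, j)] is [H_(i+j+1)]; the columns are indexed by [nat * 'I_m]. *)
Definition hankel_row H (i : nat) (c : 'I_m) : nat * 'I_m -> R :=
  fun jb => H (i + jb.1).+1 c jb.2.

Definition retained H (i : nat) (c : 'I_m) : Prop :=
  ~ exists a : nat -> 'I_m -> R, forall jb,
      hankel_row H i c jb =
      \sum_(i' < i.+1) \sum_(c' < m | (i' < i)%N || (c' < c)%N)
        a i' c' * hankel_row H i' c' jb.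

Definition has_kronecker_index H (c : 'I_m) (n : nat) : Prop :=
  ([set i | retained H i c] #= `I_n)%card.

Definition generic_class (p : nat) : set (l2mx R m) :=
  [set s | linear_system s /\ forall c, has_kronecker_index s c p].

End systems.

(* Main.v *)
Require Import Defs.
From mathcomp Require Import all_boot all_order all_algebra.
From mathcomp Require Import complex ring lra zify.
From mathcomp Require Import all_classical all_reals all_analysis.

Set Implicit Arguments.
Unset Strict Implicit.
Unset Printing Implicit Defensive.

Import Order.TTheory GRing.Theory Num.Theory.
Import numFieldNormedType.Exports.

Local Open Scope classical_set_scope.
Local Open Scope ring_scope.

(** The systems with all Kronecker indices equal to [p] form a single coordinate
    patch. Number the rows of the Hankel matrix consecutively, and put
    [n := p * m]. That all indices are [p] means that the first [n] rows are
    linearly independent and that the next [m] rows depend on them. The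
    coefficients of this dependence form a matrix [A] of size [m * n], and
    shifting the Hankel matrix shows that its block of the first [n] rows and
    of the block column [k] is [F ^ k X], where [F] is the companion matrix of
    [A] and [X] is the first block column. Hence the system is determined by
    [(A, X)], i.e. by [2 p m ^ 2] real numbers, through
    [H_0 = 1] and [H_(k+1) = C F ^ k X], where [C] selects the first [m] rows
    ([generic_markov]).

    The admissible pairs [(A, X)] are those for which [F] is stable and the
    matrices [F ^ k X] have no common left annihilator. By Cayley-Hamilton,
    [k < n] suffices in the last condition, which then says that the Gram matrix
    [\sum_(k < n) F ^ k X (F ^ k X)^T] is invertible ([unitmx_gram]). Stability
    is taken in the form: some power of [F] has small norm. Both conditions are
    open. An admissible pair gives a system of the class ([markov_generic]); its
    poles lie in the open disc since a root [z] of a denominator with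
    [|z| >= 1] is a root of the numerator too, because the Markov parameters
    tend to 0 ([fraction_pole]). Conversely, the Markov parameters of a system of
    the class are square-summable, so that [F ^ k X] tends to 0; as the Gram
    matrix is invertible, so does [F ^ k] ([stable_krylov]).

    It remains to see that the parametrization is smooth as a map into the
    Hilbert space. Consider more generally the sequences [C F ^ k X] where [F]
    and [X] are affine functions of the parameters. The difference quotient in
    a direction in which [F] and [X] have increments [h V] and [h W] is exactly
    the sequence of the same kind with output matrix [row_mx C 0], transition
    matrix [block_mx F V 0 (F + h V)] and initial state [col_mx W (X + h W)]
    ([response_quotient]). Its limit as [h] tends to 0 is again of this kind,
    with affine data and a stable matrix, so that differentiability of every
    order follows by induction from continuity alone ([smooth_on_response]).
    Continuity holds by dominated convergence, since near a stable matrix all powers are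
    bounded by one geometric sequence ([stable_near], [cvg_response]).

    The inverse of the parametrization is continuous because [X] is read off
    from the system, and [F] is obtained by inverting the Gram matrix
    ([gram_shift]). The parametrization is an immersion: if its derivative in
    a direction vanishes, the first order variation of [X] vanishes, that of the
    identity [X_(k+1) = F X_k] gives [V F ^ k X = 0] for all [k], and so [V = 0]
    ([param_immersion]). *)

(** * Convergence of matrices *)

Section matrix_convergence.
Context {R : realType} {T : Type} {F : set_system T} {FF : Filter F}.

Lemma cvg_sumr (V : normedModType R) (I : Type) (r : seq I) (P : pred I)
    (f : I -> T -> V) (a : I -> V) :
  (forall i, P i -> f i @ F --> a i) ->
  (fun t => \sum_(i <- r | P i) f i t) @ F --> \sum_(i <- r | P i) a i.
Proof. by move=> fa; apply: cvg_big => //; exact: add_continuous. Qed.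

Lemma cvg_prodr (I : Type) (r : seq I) (P : pred I)
    (f : I -> T -> R) (a : I -> R) :
  (forall i, P i -> f i @ F --> a i) ->
  (fun t => \prod_(i <- r | P i) f i t) @ F --> \prod_(i <- r | P i) a i.
Proof. by move=> fa; apply: cvg_big => //; exact: mul_continuous. Qed.

Lemma ler_mxnormP p q (A : 'M[R]_(p, q)) (c : R) :
  0 <= c -> (`|A| <= c) <-> (forall i j, `|A i j| <= c).
Proof.
move=> c0; rewrite /Num.norm /= mx_normrE; split.
  by move=> /bigmax_leP[_ h] i j; exact: (h (i, j)).
by move=> h; apply/bigmax_leP; split=> // -[i j] _; exact: h.
Qed.

Lemma ler_entry_mxnorm p q (A : 'M[R]_(p, q)) i j : `|A i j| <= `|A|.
Proof. exact: (ler_mxnormP A (normr_ge0 A)).1. Qed.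

Lemma ltr_mxnormP p q (A : 'M[R]_(p, q)) (c : R) :
  0 < c -> (forall i j, `|A i j| < c) -> `|A| < c.
Proof.
move=> c0 h; rewrite /Num.norm /= mx_normrE.
by apply/bigmax_ltP; split=> // -[i j] _; exact: h.
Qed.

Lemma cvg_mxP p q (f : T -> 'M[R]_(p, q)) (A : 'M[R]_(p, q)) :
  (f @ F --> A) <-> (forall i j, (fun t => f t i j) @ F --> A i j).
Proof.
split=> [fA i j|fA].
  by apply: (cvg_comp _ (fun M : 'M[R]_(p, q) => M i j) fA); exact: coord_continuous.
apply/cvgrPdist_lt => e e0.
have := @filter_forall T ('I_p * 'I_q)%type
  (fun ij t => `|A ij.1 ij.2 - f t ij.1 ij.2| < e) F FF.
move=> /(_ _)/filterS; apply => [t h|[i j]]; last first.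
  by move: (fA i j) => /cvgrPdist_lt /(_ _ e0).
by apply: ltr_mxnormP => // i j; rewrite !mxE; exact: (h (i, j)).
Qed.

Lemma cvg_mulmx p q r (f : T -> 'M[R]_(p, q)) (g : T -> 'M[R]_(q, r))
    (A : 'M[R]_(p, q)) (B : 'M[R]_(q, r)) :
  f @ F --> A -> g @ F --> B -> (fun t => f t *m g t) @ F --> A *m B.
Proof.
move=> /cvg_mxP fA /cvg_mxP gB; apply/cvg_mxP => i j; rewrite mxE.
under eq_fun do rewrite mxE.
by apply: cvg_sumr => k _; apply: cvgM; [exact: fA|exact: gB].
Qed.

Lemma cvg_expmx n (f : T -> 'M[R]_n) (A : 'M[R]_n) k :
  f @ F --> A -> (fun t => f t ^+ k) @ F --> A ^+ k.
Proof.
move=> fA; elim: k => [|k IH]; first by under eq_fun do rewrite expr0; exact: cvg_cst.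
by under eq_fun do rewrite exprS; rewrite exprS; exact: cvg_mulmx.
Qed.

Lemma cvg_trmx p q (f : T -> 'M[R]_(p, q)) (A : 'M[R]_(p, q)) :
  f @ F --> A -> (fun t => (f t)^T) @ F --> A^T.
Proof.
move=> /cvg_mxP fA; apply/cvg_mxP => i j; rewrite mxE.
by under eq_fun do rewrite mxE; exact: fA.
Qed.

Lemma cvg_row_mx p q r (f : T -> 'M[R]_(p, q)) (g : T -> 'M[R]_(p, r))
    (A : 'M[R]_(p, q)) (B : 'M[R]_(p, r)) :
  f @ F --> A -> g @ F --> B -> (fun t => row_mx (f t) (g t)) @ F --> row_mx A B.
Proof.
move=> /cvg_mxP fA /cvg_mxP gB; apply/cvg_mxP => i j; rewrite mxE.
under eq_fun do rewrite mxE.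
by case: (fintype.split j) => k; [exact: fA|exact: gB].
Qed.

Lemma cvg_col_mx p q r (f : T -> 'M[R]_(p, r)) (g : T -> 'M[R]_(q, r))
    (A : 'M[R]_(p, r)) (B : 'M[R]_(q, r)) :
  f @ F --> A -> g @ F --> B -> (fun t => col_mx (f t) (g t)) @ F --> col_mx A B.
Proof.
move=> /cvg_mxP fA /cvg_mxP gB; apply/cvg_mxP => i j; rewrite mxE.
under eq_fun do rewrite mxE.
by case: (fintype.split i) => k; [exact: fA|exact: gB].
Qed.

Lemma cvg_det n (f : T -> 'M[R]_n) (A : 'M[R]_n) :
  f @ F --> A -> (fun t => \det (f t)) @ F --> \det A.
Proof.
move=> /cvg_mxP fA; apply: cvg_sumr => s _; apply: cvgM; first exact: cvg_cst.
by apply: cvg_prodr => i _; exact: fA.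
Qed.

Lemma cvg_adj n (f : T -> 'M[R]_n) (A : 'M[R]_n) :
  f @ F --> A -> (fun t => \adj (f t)) @ F --> \adj A.
Proof.
move=> /cvg_mxP fA; apply/cvg_mxP => i j; rewrite mxE.
under eq_fun do rewrite mxE.
apply: cvgM; first exact: cvg_cst.
apply: cvg_det; apply/cvg_mxP => k l; rewrite !mxE.
by under eq_fun do rewrite !mxE; exact: fA.
Qed.

Lemma near_unitmx n (f : T -> 'M[R]_n) (A : 'M[R]_n) :
  f @ F --> A -> A \in unitmx -> \forall t \near F, f t \in unitmx.
Proof.
move=> /cvg_det fA; rewrite unitmxE unitfE => A0.
have : 0 < `|\det A| by rewrite normr_gt0.
move/cvgrPdist_lt: fA => /[apply]; apply: filterS => t.
rewrite unitmxE unitfE; apply: contraTneq => ->.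
by rewrite subr0 ltxx.
Qed.

Lemma cvg_invmx n (f : T -> 'M[R]_n) (A : 'M[R]_n) :
  A \in unitmx -> f @ F --> A -> (fun t => invmx (f t)) @ F --> invmx A.
Proof.
move=> uA fA; have uf := near_unitmx fA uA.
have -> : invmx A = (\det A)^-1 *: \adj A by rewrite /invmx uA.
have : (fun t => (\det (f t))^-1 *: \adj (f t)) @ F --> (\det A)^-1 *: \adj A.
  apply: cvgZ; last exact: cvg_adj.
  apply: cvgV; last exact: cvg_det.
  by move: uA; rewrite unitmxE unitfE.
apply: cvg_trans; apply: near_eq_cvg.
by apply: filterS uf => t uft; rewrite /invmx uft.
Qed.

End matrix_convergence.

(** * Stable matrices *)

Section stability.
Variable R : realType.

Lemma ler_norm_mulmx p q r (A : 'M[R]_(p, q)) (B : 'M[R]_(q, r)) :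
  `|A *m B| <= q%:R * `|A| * `|B|.
Proof.
apply/ler_mxnormP => [|i j]; first by rewrite !mulr_ge0.
rewrite mxE; apply: le_trans (ler_norm_sum _ _ _) _.
apply: le_trans (_ : \sum_(k < q) `|A| * `|B| <= _).
  by apply: ler_sum => k _; rewrite normrM ler_pM ?normr_ge0 ?ler_entry_mxnorm.
by rewrite sumr_const card_ord -[leLHS]mulr_natl mulrA.
Qed.

Lemma near_norm_expmx_lt {T : Type} {F : set_system T} {FF : Filter F} n
    (f : T -> 'M[R]_n) (A : 'M[R]_n) (c e : R) k :
  f @ F --> A -> c * `|A ^+ k| < e -> \forall t \near F, c * `|f t ^+ k| < e.
Proof.
move=> fA; have fAk : (fun t => f t ^+ k) @ F --> A ^+ k by exact: cvg_expmx.
have : (fun t => c * `|f t ^+ k|) @ F --> c * `|A ^+ k|.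
  by apply: cvgMl_tmp; exact: cvg_norm.
by move=> /(@cvgr_lt R T F FF _ _) h /h.
Qed.

(** Over the reals this is the condition that all complex eigenvalues lie in the
    open unit disc. The factor [n%:R] makes the maximum norm submultiplicative;
    in this form the condition is visibly open. *)
Definition stable n (A : 'M[R]_n) : Prop := exists k, n%:R * `|A ^+ k| < 1.

(** If [n * `|A ^+ N|] is less than [q < 1], this persists near [A], and
    dividing [k] by [N] bounds [`|B ^+ k|] by a constant times [q ^+ (k %/ N)].
    The uniformity of the bound is what dominated convergence needs. *)
Lemma stable_near {T : Type} {F : set_system T} {FF : Filter F} n
    (f : T -> 'M[R]_n) (A : 'M[R]_n) : f @ F --> A -> stable A ->
  exists K r : R, [/\ 0 <= K, 0 < r, r < 1,
    forall k, `|A ^+ k| <= K * r ^+ k &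
    \forall t \near F, forall k, `|f t ^+ k| <= K * r ^+ k].
Proof.
move=> fA [N AN].
have [q [q0 q1 ANq]] : exists q, [/\ 0 < q, q < 1 & n%:R * `|A ^+ N| < q].
  exists ((1 + n%:R * `|A ^+ N|) / 2).
  have : 0 <= n%:R * `|A ^+ N| by rewrite mulr_ge0.
  by split; lra.
case: N AN ANq => [|N] AN ANq.
  (* [A ^+ 0] has norm 1 unless the matrices have size 0 *)
  have n0 : n = 0%N.
    case: n f A fA AN ANq => // n f A _; rewrite expr0 => h _; exfalso.
    have := ler_entry_mxnorm (1 : 'M[R]_n.+1) 0 0.
    rewrite mxE /= normr1 => h1; move: h; rewrite ltNge => /negP; apply.
    by rewrite (le_trans h1) // ler_peMl// ler1n.
  exists 0, q; split => // [k|]; last near=> t => k;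
    by rewrite mul0r; apply/ler_mxnormP => // -[i hi]; exfalso; rewrite n0 in hi.
have [d [d0 d1 hd]] : exists d, [/\ 0 < d, d < 1 & N.+1%:R * d = 1 - q].
  exists ((1 - q) / N.+1%:R); rewrite mulrCA divff ?pnatr_eq0// mulr1.
  rewrite divr_gt0 ?subr_gt0//.
  split=> //; rewrite ltr_pdivrMr// mul1r (@lt_le_trans _ _ 1) ?ler1n//; lra.
pose r := 1 - d.
have r0 : 0 < r by rewrite subr_gt0.
have r1 : r < 1 by rewrite /r; lra.
have qr : q <= r ^+ N.+1.
  (* Bernoulli's inequality; [d] is chosen such that [1 - N.+1 d = q] *)
  have H j : 1 - j%:R * d <= r ^+ j.
    elim: j => [|j IH]; first by rewrite mul0r subr0 expr0.
    have [h|/ltW h] := leP 0 (1 - j%:R * d).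
      rewrite exprS; apply: le_trans (ler_wpM2l (ltW r0) IH).
      have : 0 <= j%:R * d * d by rewrite !mulr_ge0// ltW.
      rewrite -natr1 /r; lra.
    apply: le_trans (exprn_ge0 _ (ltW r0)); rewrite -natr1; lra.
  by have := H N.+1; rewrite hd subKr.
pose M := \sum_(j < N.+1) (`|A ^+ j| + 1).
have bound (B : 'M[R]_n) k : n%:R * `|B ^+ N.+1| < q ->
    (forall j : 'I_N.+1, `|B ^+ j| <= `|A ^+ j| + 1) ->
    `|B ^+ k| <= M / r ^+ N.+1 * r ^+ k.
  move=> BN Bj.
  have step j l : `|B ^+ (N.+1 * j + l)| <= q ^+ j * `|B ^+ l|.
    elim: j => [|j IH]; first by rewrite muln0 expr0 mul1r.
    rewrite mulnS -addnA exprD.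
    apply: le_trans (ler_norm_mulmx _ _) _.
    by rewrite [q ^+ _.+1]exprS -[leRHS]mulrA ler_pM ?mulr_ge0// ltW.
  rewrite (divn_eq k N.+1) mulnC; apply: le_trans (step _ _) _.
  have hk : (k %% N.+1 < N.+1)%N by rewrite ltn_mod.
  have BM : `|B ^+ (k %% N.+1)| <= M.
    apply: le_trans (Bj (Ordinal hk)) _.
    by rewrite /M (bigD1 (Ordinal hk)) //= lerDl sumr_ge0// => ? _; rewrite addr_ge0.
  have M0 : 0 <= M by exact: le_trans BM.
  rewrite mulrC -mulrA ler_pM ?exprn_ge0 ?(ltW q0)//.
  rewrite ler_pdivlMl ?exprn_gt0// exprD mulrC exprM.
  rewrite ler_pM ?exprn_ge0 ?(ltW r0) ?(ltW q0)//.
    by rewrite lerXn2r ?nnegrE ?exprn_ge0 ?(ltW r0) ?(ltW q0).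
  by rewrite ler_wiXn2l ?(ltW r0) ?(ltW r1)// ltnW.
exists (M / r ^+ N.+1), r; split=> //.
- apply: divr_ge0; last exact/exprn_ge0/ltW.
  by apply: sumr_ge0 => ? _; rewrite addr_ge0.
- by move=> k; apply: bound => // j; rewrite lerDl.
have smallj : \forall t \near F, forall j : 'I_N.+1, `|f t ^+ j| <= `|A ^+ j| + 1.
  apply: filter_forall => j.
  have : 1 * `|A ^+ j| < `|A ^+ j| + 1 by rewrite mul1r ltrDl.
  move=> /(near_norm_expmx_lt fA); apply: filterS => t.
  by rewrite mul1r => /ltW.
have smallN : \forall t \near F, n%:R * `|f t ^+ N.+1| < q.
  exact: near_norm_expmx_lt ANq.
near=> t => k; apply: bound; by near: t.
Unshelve. all: by end_near. Qed.

Lemma stable_exp_bound n (A : 'M[R]_n) : stable A ->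
  exists K r : R, [/\ 0 <= K, 0 < r, r < 1 & forall k, `|A ^+ k| <= K * r ^+ k].
Proof.
move=> sA; have cA : (fun=> A) @ nbhs (0 : R) --> A by exact: cvg_cst.
have [K [r [K0 r0 r1 h _]]] := stable_near cA sA.
by exists K, r.
Qed.

Lemma cvg_stable n (A : 'M[R]_n) :
  (fun k => A ^+ k) @ \oo --> (0 : 'M[R]_n) -> stable A.
Proof.
have n1 : 0 < n%:R + 1 :> R by rewrite ltr_wpDl.
move=> /cvgr0Pnorm_lt /(_ (n%:R + 1)^-1); rewrite invr_gt0 => /(_ n1).
move=> [k _ /(_ k (leqnn k))/= h]; exists k.
rewrite (@le_lt_trans _ _ ((n%:R + 1) * `|A ^+ k|)) ?ler_wpM2r ?lerDl//.
by rewrite -ltr_pdivlMl// mulr1.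
Qed.

Lemma near_stable {T : Type} {F : set_system T} {FF : Filter F} n
    (f : T -> 'M[R]_n) (A : 'M[R]_n) :
  f @ F --> A -> stable A -> \forall t \near F, stable (f t).
Proof.
move=> fA [k Ak]; have : \forall t \near F, n%:R * `|f t ^+ k| < 1.
  exact: near_norm_expmx_lt Ak.
by apply: filterS => t h; exists k.
Qed.

End stability.

Section block_triangular.
Variable R : realType.

Lemma mulmx_exprS n (A : 'M[R]_n) k : A *m A ^+ k = A ^+ k.+1.
Proof. by rewrite exprS. Qed.

Lemma mulmx_exprSr n (A : 'M[R]_n) k : A ^+ k *m A = A ^+ k.+1.
Proof. by rewrite exprSr. Qed.

Lemma exp_block_trig n1 n2 (A : 'M[R]_n1) (B : 'M[R]_(n1, n2)) (D : 'M[R]_n2) k :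
  (block_mx A B 0 D) ^+ k =
  block_mx (A ^+ k) (\sum_(i < k) A ^+ i *m B *m D ^+ (k.-1 - i)) 0 (D ^+ k).
Proof.
elim: k => [|k IH]; first by rewrite big_ord0 !expr0 -[RHS]scalar_mx_block.
rewrite exprS IH [LHS]mulmx_block !mul0mx !mulmx0 !addr0 add0r !mulmx_exprS.
congr block_mx; rewrite big_ord_recl /= expr0 mul1mx subn0 addrC; congr (_ + _).
rewrite mulmx_sumr; apply: eq_bigr => i _.
rewrite !mulmxA mulmx_exprS; congr (_ *m _ ^+ _); case: i => i /= hi.
by rewrite /bump /=; lia.
Qed.

Lemma exp_bound_stable n (A : 'M[R]_n) (K r : R) : 0 < r -> r < 1 ->
  (forall k, `|A ^+ k| <= K * r ^+ k) -> stable A.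
Proof.
move=> r0 r1 h; apply: cvg_stable; apply: norm_cvg0.
apply: (@squeeze_cvgr _ _ _ _ (fun=> 0) (geometric K r)) => //.
- by near=> k; rewrite normr_ge0 /= h.
- exact: cvg_cst.
- by apply: cvg_geometric; rewrite ger0_norm// ltW.
Unshelve. all: by end_near. Qed.

(** With [s := Num.sqrt r], the term [k * s ^+ k] is at most the sum of the
    first [k] powers of [s], which stay below [1 / (1 - s)]. *)
Lemma natmul_expr_le (r : R) : 0 < r -> r < 1 ->
  exists K s, [/\ 0 <= K, 0 < s, s < 1 & forall k, k%:R * r ^+ k <= K * s ^+ k].
Proof.
move=> r0 r1; pose s := Num.sqrt r.
have s0 : 0 < s by rewrite sqrtr_gt0.
have s1 : s < 1 by rewrite -[ltRHS]sqrtr1 ltr_sqrt.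
exists (1 - s)^-1, s; split=> //; first by rewrite invr_ge0 subr_ge0 ltW.
move=> k; have -> : r = s * s by rewrite -expr2 sqr_sqrtr// ltW.
rewrite exprMn mulrA ler_wpM2r ?exprn_ge0 ?(ltW s0)//.
apply: (@le_trans _ _ (series (geometric 1 s) k)); last first.
  rewrite -[leRHS]mul1r; apply: geometric_le_lim => //.
  by rewrite ger0_norm// ltW.
have -> : k%:R * s ^+ k = \sum_(i < k) s ^+ k by rewrite sumr_const card_ord mulr_natl.
rewrite /series /= big_mkord.
by apply: ler_sum => i _; rewrite mul1r ler_wiXn2l ?(ltW s0) ?(ltW s1)// ltnW.
Qed.

(** The off-diagonal block of the [k]-th power has [k] terms, each bounded by a
    multiple of [r ^+ k]; the factor [k] is absorbed by a slower geometric
    decay. *)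
Lemma stable_block_trig n1 n2 (A : 'M[R]_n1) (B : 'M[R]_(n1, n2)) (D : 'M[R]_n2) :
  stable A -> stable D -> stable (block_mx A B 0 D).
Proof.
move=> /stable_exp_bound[K1 [r1 [K10 r10 r11 hA]]].
move=> /stable_exp_bound[K2 [r2 [K20 r20 r21 hD]]].
pose r := Num.max r1 r2.
have r0 : 0 < r by rewrite lt_max r10.
have lr1 : r < 1 by rewrite gt_max r11.
have [K [s [K0 s0 s1 hs]]] := natmul_expr_le r0 lr1.
pose K' := n2%:R * (n1%:R * K1 * `|B|) * K2 / r.
have K'0 : 0 <= K' by rewrite !mulr_ge0// invr_ge0 ltW.
pose t := Num.max r s.
have t0 : 0 < t by rewrite lt_max r0.
have t1 : t < 1 by rewrite gt_max lr1.
have le_exp (x y : R) k : 0 < x -> x <= y -> x ^+ k <= y ^+ k.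
  by move=> x0 xy; rewrite lerXn2r ?nnegrE ?(ltW x0) ?(le_trans (ltW x0) xy).
have {}hA k : `|A ^+ k| <= K1 * r ^+ k.
  by rewrite (le_trans (hA k))// ler_wpM2l// le_exp// !le_max lexx.
have {}hD k : `|D ^+ k| <= K2 * r ^+ k.
  by rewrite (le_trans (hD k))// ler_wpM2l// le_exp// !le_max lexx orbT.
have rt : r <= t by rewrite le_max lexx.
apply: (exp_bound_stable (K := K1 + K2 + K' * K) t0 t1) => k.
have rtk : r ^+ k <= t ^+ k by exact: le_exp.
have tk : 0 <= t ^+ k by rewrite exprn_ge0 ?(ltW t0).
have hA' : `|A ^+ k| <= K1 * t ^+ k by rewrite (le_trans (hA k))// ler_wpM2l.
have hD' : `|D ^+ k| <= K2 * t ^+ k by rewrite (le_trans (hD k))// ler_wpM2l.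
have hB' : `|\sum_(i < k) A ^+ i *m B *m D ^+ (k.-1 - i)| <= K' * K * t ^+ k.
  apply: le_trans (ler_norm_sum _ _ _) _.
  apply: (@le_trans _ _ (\sum_(i < k) K' * r ^+ k)).
    apply: ler_sum => i _.
    have ek : (i + (k.-1 - i)).+1 = k.
      by case: k i {rtk tk hA' hD'} => [[]//|k] i; rewrite subnKC// -ltnS.
    have -> : K' * r ^+ k = n2%:R * (n1%:R * (K1 * r ^+ i) * `|B|) *
        (K2 * r ^+ (k.-1 - i)).
      rewrite -[X in r ^+ X]ek exprS exprD /K'.
      by field; rewrite gt_eqF.
    apply: le_trans (ler_norm_mulmx _ _) _.
    rewrite ler_pM ?mulr_ge0// ler_wpM2l//.
    by apply: le_trans (ler_norm_mulmx _ _) _; rewrite ler_wpM2r// ler_wpM2l.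
  rewrite sumr_const card_ord -[leLHS]mulr_natl mulrCA -[leRHS]mulrA ler_wpM2l//.
  apply: le_trans (hs k) _; rewrite ler_wpM2l// le_exp// le_max lexx orbT//.
rewrite exp_block_trig; apply/ler_mxnormP => [|i j].
  by rewrite mulr_ge0// !addr_ge0// mulr_ge0.
rewrite !mulrDl.
have e1 : 0 <= K1 * t ^+ k by rewrite mulr_ge0.
have e2 : 0 <= K2 * t ^+ k by rewrite mulr_ge0.
have e3 : 0 <= K' * K * t ^+ k by rewrite mulr_ge0// mulr_ge0.
case: (split_ordP i) => i' ->; case: (split_ordP j) => j' ->;
  rewrite ?block_mxEul ?block_mxEur ?block_mxEdl ?block_mxEdr.
- have := ler_entry_mxnorm (A ^+ k) i' j'; lra.
- have := ler_entry_mxnorm (\sum_(i < k) A ^+ i *m B *m D ^+ (k.-1 - i)) i' j'; lra.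
- by rewrite mxE normr0; lra.
- have := ler_entry_mxnorm (D ^+ k) i' j'; lra.
Qed.

End block_triangular.

(** * Impulse responses as points of the Hilbert space *)

Section response.
Variables (R : realType) (m : nat).
Local Notation l2 := (l2mx R m).

Lemma mxdot_le_norm (A : 'M[R]_m) (K : R) :
  `|A| <= K -> mxdot A A <= m%:R ^+ 2 * K ^+ 2.
Proof.
move=> AK; have K0 := le_trans (normr_ge0 A) AK.
rewrite mxdotE; apply: (@le_trans _ _ (\sum_(i < m) \sum_(j < m) K ^+ 2)).
  apply: ler_sum => i _; apply: ler_sum => j _.
  rewrite -expr2 -real_normK ?num_real// lerXn2r ?nnegrE//.
  exact: le_trans (ler_entry_mxnorm A i j) AK.
by rewrite !sumr_const !card_ord -!mulrnA -[leLHS]mulr_natl natrM expr2.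
Qed.

Lemma geometric_sqsum (s : nat -> 'M[R]_m) (K r : R) : 0 < r -> r < 1 ->
  (forall k, `|s k| <= K * r ^+ k) -> s \in @sqsum R m.
Proof.
move=> r0 r1 h; apply/asboolP.
apply: (@series_le_cvg R _ (geometric (m%:R ^+ 2 * K ^+ 2) (r ^+ 2))).
- by move=> k; exact: mxdot_ge0.
- move=> k /=; apply: mulr_ge0; last by rewrite !exprn_ge0 ?(ltW r0).
  by rewrite mulr_ge0 ?sqr_ge0.
- move=> k /=; apply: le_trans (mxdot_le_norm (h k)) _.
  by rewrite exprMn -exprM mulnC exprM mulrA.
- apply: is_cvg_geometric_series.
  by rewrite normrX ger0_norm ?(ltW r0)// exprn_ilt1 // ltW.
Qed.

Lemma l2dot_tail_le (u : l2) (N : nat) (K q : R) : 0 <= K -> 0 < q -> q < 1 ->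
  (forall k, mxdot (u k) (u k) <= K * q ^+ k) ->
  l2dot u u <= \sum_(k < N) mxdot (u k) (u k) + K / (1 - q) * q ^+ N.
Proof.
move=> K0 q0 q1 h; apply: limr_le; first exact: is_cvg_l2dot.
near=> n.
have Nn : (N <= n)%N by near: n; exact: nbhs_infty_ge.
rewrite /dot_series /series /= (big_cat_nat _ Nn)//= big_mkord lerD2l.
apply: (@le_trans _ _ (\sum_(N <= k < n) K * q ^+ k)).
  by apply: ler_sum => k _.
rewrite -mulr_sumr -[leRHS]mulrA ler_wpM2l//.
rewrite -(subnKC Nn) geometric_partial_tail mulrC.
apply: geometric_le_lim => //; first by rewrite exprn_ge0 ?ltW.
by rewrite ger0_norm// ltW.
Unshelve. all: by end_near. Qed.

Lemma cvg_mxdot {T : Type} {F : set_system T} {FF : Filter F}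
    (f g : T -> 'M[R]_m) (A B : 'M[R]_m) :
  f @ F --> A -> g @ F --> B -> (fun t => mxdot (f t) (g t)) @ F --> mxdot A B.
Proof.
move=> /cvg_mxP fA /cvg_mxP gB; rewrite mxdotE.
under eq_fun do rewrite mxdotE.
apply: (@cvg_sumr R T F FF R^o) => i _; apply: (@cvg_sumr R T F FF R^o) => j _.
by apply: cvgM; [exact: fA|exact: gB].
Qed.

(** Dominated convergence: a geometric bound makes the tails uniformly small, so
    that termwise convergence suffices. *)
Lemma cvg_l2_dominated {T : Type} {F : set_system T} {FF : Filter F}
    (g : T -> l2) (g0 : l2) (K r : R) : 0 < r -> r < 1 ->
  (\forall t \near F, forall k, `|g0 k - g t k| <= K * r ^+ k) ->
  (forall k, (fun t => g t k) @ F --> g0 k) -> g @ F --> g0.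
Proof.
move=> r0 r1 hdom hcvg; apply/cvgrPdist_lt => e e0.
pose K' := m%:R ^+ 2 * K ^+ 2; pose q := r ^+ 2.
have K'0 : 0 <= K' by rewrite mulr_ge0 ?sqr_ge0.
have q0 : 0 < q by rewrite exprn_gt0.
have q1 : q < 1 by rewrite exprn_ilt1 // ltW.
have e2 : 0 < e ^+ 2 / 2 by rewrite divr_gt0 ?exprn_gt0.
have [N hN] : exists N, K' / (1 - q) * q ^+ N < e ^+ 2 / 2.
  have q1' : `|q| < 1 by rewrite ger0_norm// ltW.
  have /cvgr0Pnorm_lt /(_ _ e2) [N _ /(_ N (leqnn N)) /= hN] :=
    cvg_geometric (K' / (1 - q)) q1'.
  by exists N; exact: le_lt_trans (ler_norm _) hN.
have hS : (fun t => \sum_(k < N) mxdot (g0 k - g t k) (g0 k - g t k)) @ F --> (0 : R).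
  have h0 k : (fun t => mxdot (g0 k - g t k) (g0 k - g t k)) @ F --> (0 : R).
    have -> : (0 : R) = mxdot (0 : 'M[R]_m) 0 by rewrite /mxdot mul0mx mxtrace0.
    have hk : (fun t => g0 k - g t k) @ F --> (0 : 'M[R]_m).
      by rewrite -[0](subrr (g0 k)); apply: cvgB => //; exact: cvg_cst.
    exact: cvg_mxdot.
  have := @cvg_sumr R T F FF R^o _ (index_enum 'I_N) xpredT _ _ (fun k _ => h0 k).
  by rewrite big1.
have hS' : \forall t \near F,
    \sum_(k < N) mxdot (g0 k - g t k) (g0 k - g t k) < e ^+ 2 / 2.
  move/cvgr0Pnorm_lt: hS => /(_ _ e2); apply: filterS => t.
  exact/le_lt_trans/ler_norm.
near=> t.
have h1 : \sum_(k < N) mxdot (g0 k - g t k) (g0 k - g t k) < e ^+ 2 / 2.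
  by near: t.
have h2 : forall k, `|g0 k - g t k| <= K * r ^+ k by near: t.
have -> : `|g0 - g t| = l2norm (g0 - g t) by [].
have -> : e = Num.sqrt (e ^+ 2) by rewrite sqrtr_sqr ger0_norm// ltW.
rewrite /l2norm ltr_sqrt ?exprn_gt0//.
apply: le_lt_trans (@l2dot_tail_le (g0 - g t) N K' q K'0 q0 q1 _) _; last first.
  rewrite [ltRHS]splitr; exact: ltrD.
move=> k; apply: le_trans (mxdot_le_norm (h2 k)) _.
by rewrite exprMn -exprM mulnC exprM mulrA.
Unshelve. all: by end_near. Qed.

(** The default value 0 of [insubd] is reached only if the sequence is not
    square-summable, which does not happen for a stable [A]. *)
Definition response n (C : 'M[R]_(m, n)) (A : 'M[R]_n) (X : 'M[R]_(n, m)) : l2 :=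
  insubd 0 (fun k => C *m A ^+ k *m X).

Lemma response_bound n (C : 'M[R]_(m, n)) (A : 'M[R]_n) (X : 'M[R]_(n, m))
    (K c r : R) k :
  0 <= K -> 0 < r -> `|A ^+ k| <= K * r ^+ k -> `|X| <= c ->
  `|C *m A ^+ k *m X| <= n%:R * (n%:R * `|C| * K) * c * r ^+ k.
Proof.
move=> K0 r0 hA hX; apply: le_trans (ler_norm_mulmx _ _) _.
have -> : n%:R * (n%:R * `|C| * K) * c * r ^+ k =
    n%:R * (n%:R * `|C| * (K * r ^+ k)) * c by ring.
rewrite ler_pM ?mulr_ge0// ler_wpM2l//.
by apply: le_trans (ler_norm_mulmx _ _) _; rewrite ler_wpM2l// mulr_ge0.
Qed.

Lemma responseE n (C : 'M[R]_(m, n)) (A : 'M[R]_n) (X : 'M[R]_(n, m)) k :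
  stable A -> response C A X k = C *m A ^+ k *m X.
Proof.
move=> /stable_exp_bound[K [r [K0 r0 r1 hA]]].
rewrite /response insubdK //; apply: (geometric_sqsum r0 r1) => j.
exact: (response_bound C K0 r0 (hA j) (lexx `|X|)).
Qed.

Lemma cvg_response {T : Type} {F : set_system T} {FF : Filter F} n
    (C : 'M[R]_(m, n)) (A : T -> 'M[R]_n) (A0 : 'M[R]_n)
    (X : T -> 'M[R]_(n, m)) (X0 : 'M[R]_(n, m)) :
  stable A0 -> A @ F --> A0 -> X @ F --> X0 ->
  (fun t => response C (A t) (X t)) @ F --> response C A0 X0.
Proof.
move=> sA0 hA hX.
have [K [r [K0 r0 r1 hK hKt]]] := stable_near hA sA0.
have sA : \forall t \near F, stable (A t) by exact: near_stable sA0.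
have hX1 : \forall t \near F, `|X t| <= `|X0| + 1.
  by apply: (cvgr_le _ (cvg_norm hX)); rewrite ltrDl.
pose c := n%:R * (n%:R * `|C| * K) * (`|X0| + 1).
apply: (@cvg_l2_dominated T F FF _ _ (c + c) r) => //.
  near=> t => k; rewrite !responseE//; last by near: t.
  rewrite mulrDl; apply: le_trans (ler_normB _ _) _.
  apply: lerD; apply: response_bound => //; first by rewrite lerDl.
    by move: k; near: t.
  by near: t.
move=> k; rewrite responseE//.
have : (fun t => C *m A t ^+ k *m X t) @ F --> C *m A0 ^+ k *m X0.
  by apply: cvg_mulmx hX; apply: cvg_mulmx; [exact: cvg_cst|exact: cvg_expmx].
apply: cvg_trans; apply: near_eq_cvg.
by near=> t; rewrite responseE//; near: t.
Unshelve. all: by end_near. Qed.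

End response.

(** * Smoothness of impulse responses *)

Section Ck_on_theory.
Variables (R : realType) (V W : normedModType R).
Implicit Types (U : set V) (f g : V -> W).

Lemma cvg_line (x v : V) : (fun h : R => h *: v + x) @ 0^' --> x.
Proof.
have : (fun h : R => h *: v + x) @ nbhs (0 : R) --> 0 *: v + x.
  by apply: cvgD; [apply: cvgZr_tmp; exact: cvg_id|exact: cvg_cst].
by rewrite scale0r add0r => /cvg_within_filter; apply.
Qed.

Lemma near_line U (x v : V) : open U -> U x ->
  \forall h \near (0 : R)^', U (h *: v + x).
Proof. by move=> oU Ux; apply: (@cvg_line x v); exact: open_nbhs_nbhs. Qed.

Lemma derivable_derive_eq f (x v : V) (l : W) :
  (fun h : R => h^-1 *: (f (h *: v + x) - f x)) @ 0^' --> l ->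
  derivable f x v /\ 'D_v f x = l.
Proof. by move=> fl; split; [exact: cvgP fl|exact: cvg_lim fl]. Qed.

Lemma derivable_cvg f (x v : V) : derivable f x v ->
  (fun h : R => h^-1 *: (f (h *: v + x) - f x)) @ 0^' --> 'D_v f x.
Proof. by []. Qed.

Lemma derive_near_eq U f g (x v : V) : open U -> U x ->
  (forall y, U y -> f y = g y) -> derivable f x v ->
  derivable g x v /\ 'D_v g x = 'D_v f x.
Proof.
move=> oU Ux fg /derivable_cvg fl; apply: derivable_derive_eq.
apply: cvg_trans fl; apply: near_eq_cvg.
near=> h; rewrite !fg//; near: h; exact: near_line.
Unshelve. all: by end_near. Qed.

Lemma continuous_near_eq U f g (x : V) : open U -> U x ->
  (forall y, U y -> f y = g y) -> {for x, continuous f} -> {for x, continuous g}.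
Proof.
move=> oU Ux fg fx; have : f @ x --> f x by [].
rewrite fg//; apply: cvg_trans; apply: near_eq_cvg; near=> y; apply: fg.
by near: y; exact: open_nbhs_nbhs.
Unshelve. all: by end_near. Qed.

(** Derivatives at a point of an open set are determined by the values on this
    set, at every order. *)
Lemma Ck_on_eq k U f g : open U -> (forall x, U x -> f x = g x) ->
  Ck_on k U f -> Ck_on k U g.
Proof.
move=> oU; elim: k f g => [|k IH] f g fg [fc fd].
  by split=> // x Ux; exact: (continuous_near_eq oU Ux fg (fc x Ux)).
split=> [x Ux|v]; first exact: (continuous_near_eq oU Ux fg (fc x Ux)).
have [fv fk] := fd v; split=> [x Ux|].
  by have [] := derive_near_eq oU Ux fg (fv x Ux).
apply: IH fk => x Ux.
by have [_ ->] := derive_near_eq oU Ux fg (fv x Ux).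
Qed.

Lemma Ck_on_cst k U (a : W) : Ck_on k U (fun=> a).
Proof.
elim: k a => [|k IH] a; first by split=> // x _; exact: cvg_cst.
split=> [x _|v]; first exact: cvg_cst.
split=> [x _|]; first exact: derivable_cst.
by under eq_fun do rewrite derive_cst.
Qed.

End Ck_on_theory.

Lemma smooth_on_id (R : realType) (V : normedModType R) (U : set V) :
  smooth_on U (@id V).
Proof.
case=> [|k]; first by split=> // x _; exact: cvg_id.
split=> [x _|v]; first exact: cvg_id.
split=> [x _|]; first exact: derivable_id.
by under eq_fun do rewrite derive_id; exact: Ck_on_cst.
Qed.

Section smooth_response.
Variables (R : realType) (m : nat) (V : normedModType R) (U : set V).
Hypothesis oU : open U.

Lemma expB_sum n (A B : 'M[R]_n) k :
  B ^+ k - A ^+ k = \sum_(i < k) A ^+ i *m (B - A) *m B ^+ (k.-1 - i).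
Proof.
elim: k => [|k IH]; first by rewrite big_ord0 !expr0 subrr.
rewrite big_ord_recl /= expr0 mul1mx subn0.
have -> : \sum_(i < k) A ^+ bump 0 i *m (B - A) *m B ^+ (k - bump 0 i) =
    A *m (B ^+ k - A ^+ k).
  rewrite IH mulmx_sumr; apply: eq_bigr => i _.
  rewrite !mulmxA mulmx_exprS; congr (_ *m _ ^+ _).
  by case: k {IH} i => [[]//|k] i; rewrite /= subSS.
by rewrite mulmxBl mulmxBr !mulmx_exprS addrA subrK.
Qed.

(** The off-diagonal block of the power of the block triangular matrix is
    [\sum_i A ^+ i A' B ^+ (k - 1 - i)] with [B = A + h A'], and [h] times this sum
    telescopes to [B ^+ k - A ^+ k]. *)
Lemma response_quotient n (C : 'M[R]_(m, n)) (A A' : 'M[R]_n)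
    (X X' : 'M[R]_(n, m)) (h : R) :
  stable A -> stable (A + h *: A') -> h != 0 ->
  h^-1 *: (response C (A + h *: A') (X + h *: X') - response C A X) =
  response (row_mx C 0) (block_mx A A' 0 (A + h *: A'))
    (col_mx X' (X + h *: X')).
Proof.
move=> sA sA' h0; apply: val_inj; apply/funext => k.
have -> : val (h^-1 *: (response C (A + h *: A') (X + h *: X') - response C A X)) k
  = h^-1 *: (response C (A + h *: A') (X + h *: X') k - response C A X k) by [].
rewrite -[RHS]/(response (row_mx C 0) _ _ k) !responseE//; last first.
  exact: stable_block_trig.
rewrite exp_block_trig mul_row_block mul_row_col !mul0mx !addr0.
set B := A + h *: A'.
have hS : h *: (\sum_(i < k) A ^+ i *m A' *m B ^+ (k.-1 - i)) = B ^+ k - A ^+ k.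
  rewrite expB_sum scaler_sumr; apply: eq_bigr => i _.
  by rewrite /B [A + _]addrC addrK -scalemxAr -scalemxAl.
have -> : \sum_(i < k) A ^+ i *m A' *m B ^+ (k.-1 - i) = h^-1 *: (B ^+ k - A ^+ k).
  by rewrite -hS scalerA mulVf// scale1r.
rewrite -[in RHS]scalemxAr -[in RHS]scalemxAl.
have -> : C *m A ^+ k *m X' = h^-1 *: (C *m A ^+ k *m (h *: X')).
  by rewrite -scalemxAr scalerA mulVf// scale1r.
rewrite -scalerDr; congr (_ *: _).
rewrite mulmxBr mulmxBl !mulmxDr.
by rewrite opprD [in RHS]addrC -!addrA addNr addr0.
Qed.

(** The difference quotient being itself a response, its limit is given by the
    continuity of responses. *)
Lemma response_derive n (C : 'M[R]_(m, n)) (A A' : V -> 'M[R]_n)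
    (X X' : V -> 'M[R]_(n, m)) (x v : V) :
  continuous A -> continuous X ->
  (forall y w t, A (t *: w + y) = A y + t *: A' w) ->
  (forall y w t, X (t *: w + y) = X y + t *: X' w) ->
  (forall y, U y -> stable (A y)) -> U x ->
  derivable (fun y => response C (A y) (X y)) x v /\
  'D_v (fun y => response C (A y) (X y)) x =
  response (row_mx C 0) (block_mx (A x) (A' v) 0 (A x)) (col_mx (X' v) (X x)).
Proof.
move=> cA cX hA hX sA Ux; apply: derivable_derive_eq.
have : (fun h : R => response (row_mx C 0)
      (block_mx (A x) (A' v) 0 (A (h *: v + x)))
      (col_mx (X' v) (X (h *: v + x)))) @ 0^' -->
    response (row_mx C 0) (block_mx (A x) (A' v) 0 (A x)) (col_mx (X' v) (X x)).
  apply: cvg_response; first by apply: stable_block_trig; exact: sA.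
    apply: cvg_col_mx; apply: cvg_row_mx; try exact: cvg_cst.
    exact: cvg_comp (@cvg_line _ _ x v) (cA x).
  apply: cvg_col_mx; first exact: cvg_cst.
  exact: cvg_comp (@cvg_line _ _ x v) (cX x).
apply: cvg_trans; apply: near_eq_cvg; near=> h.
have Uh : U (h *: v + x) by near: h; exact: near_line.
have h0 : h != 0 by near: h; exact: nbhs_dnbhs_neq.
by rewrite /= !hA !hX -response_quotient// -?hA; exact: sA.
Unshelve. all: by end_near. Qed.

(** The derivative is the response of a system of double size, whose data are
    again affine and stable: the induction is over all systems at once. *)
Lemma smooth_on_response n (C : 'M[R]_(m, n)) (A A' : V -> 'M[R]_n)
    (X X' : V -> 'M[R]_(n, m)) :
  continuous A -> continuous X ->
  (forall y w t, A (t *: w + y) = A y + t *: A' w) ->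
  (forall y w t, X (t *: w + y) = X y + t *: X' w) ->
  (forall y, U y -> stable (A y)) ->
  smooth_on U (fun x => response C (A x) (X x)).
Proof.
move=> + + + + + k; elim: k n C A A' X X' => [|k IH] n C A A' X X' cA cX hA hX sA.
  by split=> // x Ux; apply: cvg_response; [exact: sA|exact: cA|exact: cX].
split=> [x Ux|v].
  by apply: cvg_response; [exact: sA|exact: cA|exact: cX].
split=> [x Ux|].
  by have [] := response_derive C v cA cX hA hX sA Ux.
have smooth' : Ck_on k U (fun x => response (row_mx C 0)
    (block_mx (A x) (A' v) 0 (A x)) (col_mx (X' v) (X x))).
  apply: (IH _ _ _ (fun w => block_mx (A' w) 0 0 (A' w)) _
    (fun w => col_mx 0 (X' w))).
  - by move=> x; apply: cvg_col_mx; apply: cvg_row_mx; try exact: cvg_cst; exact: cA.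
  - by move=> x; apply: cvg_col_mx; [exact: cvg_cst|exact: cX].
  - by move=> y w t; rewrite scale_block_mx add_block_mx !scaler0 !addr0 hA.
  - by move=> y w t; rewrite scale_col_mx add_col_mx !scaler0 !addr0 hX.
  - by move=> y Uy; apply: stable_block_trig; exact: sA.
apply: Ck_on_eq oU _ smooth' => x Ux.
by have [_ ->] := response_derive C v cA cX hA hX sA Ux.
Qed.

End smooth_response.

(** * Krylov sequences and their Gram matrix *)

Section krylov.
Variable R : realType.

(** Cayley-Hamilton, applied to the remainder of ['X^k]. *)
Lemma expmx_lowcomb n (A : 'M[R]_n) k :
  exists c : 'I_n -> R, A ^+ k = \sum_(i < n) c i *: A ^+ i.
Proof.
case: n A => [|n] A; first by exists (fun=> 0); apply/matrixP => -[].
pose q := 'X^k %% char_poly A.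
have qn : (size q <= n.+1)%N.
  by rewrite -ltnS -(size_char_poly A) ltn_modp -size_poly_eq0 size_char_poly.
exists (fun i => q`_i).
have -> : A ^+ k = horner_mx A q.
  have := congr1 (horner_mx A) (divp_eq 'X^k (char_poly A)).
  by rewrite rmorphXn /= horner_mx_X rmorphD rmorphM /= Cayley_Hamilton mulr0 add0r.
rewrite [in LHS](_ : q = \poly_(i < n.+1) q`_i); last first.
  apply/polyP => i; rewrite coef_poly; case: ltnP => // h.
  by rewrite nth_default// (leq_trans qn).
rewrite poly_def rmorph_sum /=; apply: eq_bigr => i _.
by rewrite linearZ /= rmorphXn /= horner_mx_X.
Qed.

Lemma annihilating_poly n (A : 'M[R]_n) :
  exists2 d : {poly R}, d != 0 & \sum_(k < size d) d`_k *: A ^+ k = 0.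
Proof.
have [c hc] := expmx_lowcomb A n.
pose q := \poly_(i < n) (if insub i is Some j then c j else 0).
have qn : (size q < n.+1)%N by rewrite ltnS size_poly.
have sd : size ('X^n - q) = n.+1 by rewrite size_polyDl size_polyXn// size_polyN.
exists ('X^n - q); first by rewrite -size_poly_eq0 sd.
rewrite sd big_ord_recr /= coefB coefXn eqxx coef_poly ltnn subr0 scale1r hc.
rewrite -big_split big1//= => i _.
by rewrite coefB coefXn ltn_eqF// sub0r coef_poly ltn_ord valK scaleNr addNr.
Qed.

Lemma krylov_eq0 n q (A : 'M[R]_n) (X : 'M[R]_(n, q)) (v : 'rV[R]_n) :
  (forall k, (k < n)%N -> v *m (A ^+ k *m X) = 0) ->
  forall k, v *m (A ^+ k *m X) = 0.
Proof.
move=> h k; have [c ->] := expmx_lowcomb A k.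
rewrite mulmx_suml mulmx_sumr big1// => i _.
by rewrite -scalemxAl -scalemxAr h// scaler0.
Qed.

Definition gram n q (A : 'M[R]_n) (X : 'M[R]_(n, q)) : 'M[R]_n :=
  \sum_(k < n) (A ^+ k *m X) *m (A ^+ k *m X)^T.

Lemma row_self_eq0 q (w : 'rV[R]_q) : (w *m w^T) 0 0 = 0 -> w = 0.
Proof.
rewrite mxE => /eqP; rewrite psumr_eq0 => [/allP h|j _]; last first.
  by rewrite mxE -expr2 sqr_ge0.
apply/rowP => j; have := h j (mem_index_enum _).
by rewrite !mxE /= mulf_eq0 orbb => /eqP.
Qed.

(** If [v *m gram A X = 0], then the sum of the squared norms of the vectors
    [v *m (A ^+ k *m X)] for [k < n] is 0. *)
Lemma unitmx_gram n q (A : 'M[R]_n) (X : 'M[R]_(n, q)) :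
  gram A X \in unitmx <->
  (forall v : 'rV[R]_n, (forall k, v *m (A ^+ k *m X) = 0) -> v = 0).
Proof.
split=> [uG v hv|h].
  rewrite -[v](mulmxK uG) /gram mulmx_sumr big1 ?mul0mx// => k _.
  by rewrite mulmxA hv mul0mx.
rewrite -row_free_unit; apply: inj_row_free => v vG; apply/h/krylov_eq0 => k kn.
apply: row_self_eq0; apply/eqP.
have : \sum_(k < n) (v *m (A ^+ k *m X) *m (v *m (A ^+ k *m X))^T) 0 0 == 0.
  rewrite -summxE.
  under eq_bigr do rewrite [(v *m _)^T]trmx_mul mulmxA -[v *m _ *m _]mulmxA.
  by rewrite -mulmx_suml -mulmx_sumr -/(gram A X) vG mul0mx mxE.
rewrite psumr_eq0 => [/allP /(_ (Ordinal kn) (mem_index_enum _))//|i _].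
by rewrite mxE sumr_ge0// => j _; rewrite [_^T _ _]mxE -expr2 sqr_ge0.
Qed.

(** This recovers [A] from the sequence [A ^+ k *m X] by a formula that is
    continuous in this sequence. *)
Lemma gram_shift n q (A : 'M[R]_n) (X : 'M[R]_(n, q)) : gram A X \in unitmx ->
  A = (\sum_(k < n) (A ^+ k.+1 *m X) *m (A ^+ k *m X)^T) *m invmx (gram A X).
Proof.
move=> uG; apply: (canRL (mulmxK uG)); rewrite /gram mulmx_sumr.
by apply: eq_bigr => k _; rewrite !mulmxA mulmx_exprS.
Qed.

(** [A ^+ k *m gram A X] is a fixed linear combination of the matrices
    [A ^+ (k + j) *m X] for [j < n], all of which tend to 0. *)
Lemma stable_krylov n q (A : 'M[R]_n) (X : 'M[R]_(n, q)) :
  gram A X \in unitmx -> (fun k => A ^+ k *m X) @ \oo --> (0 : 'M[R]_(n, q)) ->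
  stable A.
Proof.
move=> uG AX0; apply: cvg_stable.
have -> : (fun k => A ^+ k) = (fun k =>
    (\sum_(j < n) (A ^+ (k + j) *m X) *m (A ^+ j *m X)^T) *m invmx (gram A X)).
  apply/funext => k; apply: (canRL (mulmxK uG)); rewrite /gram mulmx_sumr.
  by apply: eq_bigr => j _; rewrite exprD !mulmxA.
have S0 : (fun k => \sum_(j < n) (A ^+ (k + j) *m X) *m (A ^+ j *m X)^T) @ \oo -->
    (0 : 'M[R]_n).
  have : (fun k => \sum_(j < n) (A ^+ (k + j) *m X) *m (A ^+ j *m X)^T) @ \oo -->
      \sum_(j < n) (0 : 'M[R]_(n, q)) *m (A ^+ j *m X)^T.
    apply: cvg_sumr => j _; apply: cvg_mulmx; last exact: cvg_cst.
    exact: (cvg_comp _ _ (@cvg_addnr j) AX0).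
  rewrite (_ : \sum_(j < n) (0 : 'M[R]_(n, q)) *m (A ^+ j *m X)^T = 0)//.
  by rewrite big1// => j _; rewrite mul0mx.
have : (fun k => (\sum_(j < n) (A ^+ (k + j) *m X) *m (A ^+ j *m X)^T) *m
    invmx (gram A X)) @ \oo --> 0 *m invmx (gram A X).
  by apply: cvg_mulmx S0 _; exact: cvg_cst.
by rewrite mul0mx.
Qed.

End krylov.

(** * Poles of transfer functions *)

Section poles.
Variable R : realType.

Lemma sum_coef_widen (S : nzRingType) (P : {poly S}) (f : nat -> S) N :
  (size P <= N)%N -> \sum_(k < size P) P`_k * f k = \sum_(k < N) P`_k * f k.
Proof.
move=> PN; rewrite (big_ord_widen _ (fun k => P`_k * f k) PN) big_mkcond /=.
apply: eq_bigr => k _; case: ltnP => // h.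
by rewrite nth_default// mul0r.
Qed.

(** A linear functional on polynomials, given by its values [f k] on the powers
    of ['X], is evaluated on a multiple of ['X - z%:P]. *)
Lemma sum_coef_mulXsubC (S : comNzRingType) (Q : {poly S}) (z : S) (f : nat -> S) :
  \sum_(k < size (Q * ('X - z%:P))) (Q * ('X - z%:P))`_k * f k =
  \sum_(k < size Q) Q`_k * (f k.+1 - z * f k).
Proof.
rewrite (@sum_coef_widen _ _ _ (size Q).+1); last first.
  by apply: leq_trans (size_polyMleq _ _) _; rewrite size_XsubC addn2.
under eq_bigr do rewrite mulrBr coefB coefMX coefMC mulrBl.
rewrite sumrB big_ord_recl /= mul0r add0r.
rewrite [X in _ - X]big_ord_recr /= nth_default// !mul0r addr0 -sumrB.
by apply: eq_bigr => k _; rewrite mulrBr mulrA.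
Qed.

Local Notation c := (real_complex R).

(** Write [den = Q * ('X - z)] and let [u i] be the coefficient of [z^-(i+1)] in
    the product of [Q] and the transfer function. Since [den] annihilates the
    sequence, [u i.+1 = z * u i]; since the sequence tends to 0 and [1 <= `|z|],
    [u] vanishes; and the value of [num] at [z] is [u 0]. *)
Lemma fraction_pole (m : nat) (H : nat -> 'M[R]_m) (a b : 'I_m)
    (num den : {poly R}) (z : R[i]) :
  (fun k => H k a b) @ \oo --> (0 : R) ->
  entry_fraction H a b num den -> root (map_poly (real_complex R) den) z ->
  1 <= `|z| -> root (map_poly (real_complex R) num) z.
Proof.
move=> H0 [den0 hnum hden] /factor_theorem[Q hQ] z1.
pose h k : R[i] := c (H k a b).
have sden : size (map_poly c den) = size den by rewrite size_map_poly.
pose u i := \sum_(k < size Q) Q`_k * h (k + i.+1)%N.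
have uS i : u i.+1 = z * u i.
  have := congr1 c (hden i); rewrite rmorph_sum rmorph0 /=.
  under eq_bigr do rewrite rmorphM -coef_map.
  rewrite -sden hQ (sum_coef_mulXsubC Q z (fun k => h (k + i.+1)%N)).
  under eq_bigr do rewrite mulrBr addSnnS mulrCA.
  by rewrite sumrB -mulr_sumr => /eqP; rewrite subr_eq0 => /eqP.
have uE i : u i = z ^+ i * u 0%N.
  by elim: i => [|i IH]; rewrite ?expr0 ?mul1r// uS IH mulrA -exprS.
(* [`|u i|] is at least [`|u 0|], and it tends to 0 with the sequence *)
have u0 : u 0%N = 0.
  pose q k := Num.sqrt (complex.Re Q`_k ^+ 2 + complex.Im Q`_k ^+ 2).
  have [r hr] : exists r, `|u 0%N| = c r by eexists; exact: normc_def.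
  have hc x : `|c x| = c `|x| by rewrite normc_def /= expr0n addr0 sqrtr_sqr.
  have ru i : r <= \sum_(k < size Q) q k * `|H (k + i.+1)%N a b|.
    rewrite -lecR -[X in X <= _]hr; apply: (@le_trans _ _ `|u i|).
      by rewrite (uE i) normrM normrX ler_peMl// exprn_ege1.
    apply: le_trans (ler_norm_sum _ _ _) _.
    rewrite -[X in _ <= X]/(c _) rmorph_sum; apply: ler_sum => k _.
    by rewrite normrM rmorphM /h hc normc_def.
  have cS : (fun i => \sum_(k < size Q) q k * `|H (k + i.+1)%N a b|) @ \oo -->
      \sum_(k < size Q) q k * `|0 : R|.
    apply: cvg_sumr => k _; apply: cvgMl_tmp; apply: cvg_norm.
    under eq_fun do rewrite -addSnnS.
    exact: (cvg_comp _ _ (@cvg_addnl k.+1) H0).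
  have r0 : r <= 0.
    have : r <= \sum_(k < size Q) q k * `|0 : R|.
      by apply: (cvgr_to_ge cS); near=> i; exact: ru.
    by rewrite normr0 big1// => k _; rewrite mulr0.
  by apply/eqP; rewrite -normr_le0 hr -[0]/(c 0) lecR.
have -> : root (map_poly c num) z = ((map_poly c num).[z] == 0) by [].
suff -> : (map_poly c num).[z] = u 0%N by rewrite u0.
pose e k := \sum_(j < k.+1) z ^+ j * h (k - j)%N.
have eS k : e k.+1 - z * e k = h k.+1.
  suff -> : e k.+1 = h k.+1 + z * e k by rewrite addrK.
  rewrite /e big_ord_recl expr0 mul1r subn0 mulr_sumr; congr (_ + _).
  by apply: eq_bigr => j _; rewrite lift0 subSS exprS mulrA.
transitivity (\sum_(k < size (map_poly c den)) (map_poly c den)`_k * e k); last first.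
  rewrite hQ sum_coef_mulXsubC; apply: eq_bigr => k _.
  by rewrite eS addn1.
have snum : (size (map_poly c num) <= size den)%N.
  rewrite size_map_poly; apply/leq_sizeP => j hj.
  by rewrite hnum big_geq.
rewrite (horner_coef_wide _ snum) sden /e.
transitivity (\sum_(j < size den) \sum_(k < size den | (j <= k)%N)
    (map_poly c den)`_k * h (k - j)%N * z ^+ j).
  apply: eq_bigr => j _; rewrite coef_map hnum raddf_sum /= big_geq_mkord mulr_suml.
  by apply: eq_bigr => k _; rewrite rmorphM coef_map.
rewrite (exchange_big_dep xpredT)//=; apply: eq_bigr => k _.
rewrite (big_ord_widen _ (fun j => z ^+ j * h (k - j)%N) (ltn_ord k)) mulr_sumr.
by apply: eq_bigr => j _; rewrite -mulrA [h _ * _]mulrC.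
Unshelve. all: by end_near. Qed.

End poles.

(** * Rows of the Hankel matrix and Kronecker indices *)

Section hankel.
Variables (R : realType) (m : nat).
Hypothesis hm : (0 < m)%N.
Implicit Type s : nat -> 'M[R]_m.

Definition ord_mod (t : nat) : 'I_m := Ordinal (ltn_pmod t hm).

(** Row [t] of the Hankel matrix when the rows are numbered consecutively: the
    component [t %% m] of the block row [t %/ m]. *)
Definition flat_row s (t k : nat) (b : 'I_m) : R := s (t %/ m + k).+1 (ord_mod t) b.

Lemma flat_rowD s t k b : flat_row s (t + m) k b = flat_row s t k.+1 b.
Proof.
rewrite /flat_row divnDr// divnn hm addn1 addSnnS; congr (s _ _ _).
by apply: val_inj; rewrite /= modnDr.
Qed.

Lemma hankel_row_flat s i (c : 'I_m) k b :
  hankel_row s i c (k, b) = flat_row s (i * m + c) k b.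
Proof.
rewrite /hankel_row /flat_row /= divnMDl// divn_small// addn0; congr (s _ _ _).
by apply: val_inj; rewrite /= modnMDl modn_small.
Qed.

Definition dependent s (t : nat) : Prop := exists a : nat -> R, forall k b,
  flat_row s t k b = \sum_(t' < t) a t' * flat_row s t' k b.

(** The lexicographic order on the pairs (block row, component) is the order of
    the flat numbering. *)
Lemma sum_lex (i c : nat) (G : nat -> R) : (c <= m)%N ->
  \sum_(i' < i.+1) \sum_(c' < m | (i' < i)%N || (c' < c)%N) G (i' * m + c')%N =
  \sum_(t < i * m + c) G t.
Proof.
move=> cm; have sumM j : \sum_(i' < j) \sum_(c' < m) G (i' * m + c')%N =
    \sum_(t < j * m) G t.
  elim: j => [|j IH]; first by rewrite !big_ord0.
  by rewrite big_ord_recr /= IH mulSnr [RHS]big_split_ord.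
rewrite big_ord_recr /= [RHS]big_split_ord /= -sumM; congr (_ + _).
  by apply: eq_bigr => i' _; apply: eq_bigl => c'; rewrite ltn_ord.
by rewrite (big_ord_widen _ (fun c' => G (i * m + c')%N) cm) ltnn.
Qed.

Lemma retained_flat s i (c : 'I_m) : retained s i c <-> ~ dependent s (i * m + c).
Proof.
suff : dependent s (i * m + c) <-> exists a : nat -> 'I_m -> R, forall jb,
    hankel_row s i c jb =
    \sum_(i' < i.+1) \sum_(c' < m | (i' < i)%N || (c' < c)%N)
      a i' c' * hankel_row s i' c' jb.
  by move=> h; rewrite /retained; split=> nh /h.
have cm := ltnW (ltn_ord c).
have key (a : nat -> R) k b : \sum_(i' < i.+1) \sum_(c' < m | (i' < i)%N || (c' < c)%N)
      a (i' * m + c')%N * hankel_row s i' c' (k, b) =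
    \sum_(t < i * m + c) a t * flat_row s t k b.
  rewrite -(sum_lex i (fun t => a t * flat_row s t k b) cm).
  by apply: eq_bigr => i' _; apply: eq_bigr => c' _; rewrite hankel_row_flat.
split=> -[a ha].
  exists (fun i' c' => a (i' * m + c')%N) => -[k b].
  by rewrite key hankel_row_flat ha.
exists (fun t => a (t %/ m)%N (ord_mod t)) => k b.
rewrite -hankel_row_flat ha -(key (fun t => a (t %/ m)%N (ord_mod t))).
apply: eq_bigr => i' _; apply: eq_bigr => c' _.
rewrite divnMDl// divn_small// addn0; congr (a _ _ * _).
by apply: val_inj; rewrite /= modnMDl modn_small.
Qed.

(** The Hankel structure: removing the first block column amounts to moving [m]
    rows down, so a linear relation between rows can be shifted. *)
Lemma dependentD s t : dependent s t -> dependent s (t + m).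
Proof.
move=> [a ha]; exists (fun t' => if (t' < m)%N then 0 else a (t' - m)%N) => k b.
rewrite flat_rowD ha [(t + m)%N]addnC big_split_ord /= [X in _ = X + _]big1; last first.
  by move=> j _; rewrite ltn_ord mul0r.
rewrite add0r; apply: eq_bigr => j _.
by rewrite ltnNge leq_addr /= [(m + j)%N]addnC addnK flat_rowD.
Qed.

(** By shifting, the retained rows of a given component are the first ones, so
    that their number determines them. *)
Lemma kronecker_indexP s (c : 'I_m) n :
  has_kronecker_index s c n <-> (forall i, retained s i c <-> (i < n)%N).
Proof.
split=> [/card_eqPle[hle hge] i|h]; last first.
  rewrite /has_kronecker_index.
  rewrite (_ : [set i | retained s i c] = `I_n); first exact: card_eqxx.
  by apply/seteqP; split=> j /h.
have down j i' : (j <= i')%N -> retained s i' c -> retained s j c.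
  move=> /subnKC <-; elim: (i' - j)%N => [|d IH]; first by rewrite addn0.
  rewrite addnS => /retained_flat hr; apply: IH; apply/retained_flat => hd.
  by apply: hr; rewrite mulSnr -addnA [(m + c)%N]addnC addnA; exact: dependentD.
split=> [hi|hi].
  have : (`I_i.+1 #<= `I_n)%card.
    apply: (card_le_trans _ hle); apply: subset_card_le => j /= ji.
    exact: down hi.
  by rewrite card_le_II.
apply: contrapT => hni.
have : (`I_n #<= `I_i)%card.
  apply: (card_le_trans hge); apply: subset_card_le => j /= hj.
  by rewrite ltnNge; apply/negP => ij; apply: hni; exact: down hj.
by rewrite card_le_II leqNgt hi.
Qed.

Section state.
Variable p : nat.
Hypothesis hp : (0 < p)%N.
Local Notation n := (p * m)%N.

(** The [p] upper blocks of the block column [k] of the Hankel matrix. *)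
Definition hankel_state s k : 'M[R]_(n, m) := \matrix_(r, b) flat_row s r k b.

Lemma independent_rows s :
  (forall t, (t < n)%N -> ~ dependent s t) ->
  forall v : 'rV[R]_n, (forall k, v *m hankel_state s k = 0) -> v = 0.
Proof.
move=> ind v hv; apply/rowP => r; rewrite mxE.
(* descending induction on [r]: the coefficients after [r] vanish, and if that
   of [r] did not, the row [r] would depend on the previous ones *)
elim/ltn_ind: {r}(n - r)%N {-2}r (erefl (n - r)%N) => N IH r Nr.
have hgt (r' : 'I_n) : (r < r')%N -> v 0 r' = 0.
  move=> rr'; apply: (IH (n - r')%N) => //.
  by rewrite -Nr ltn_sub2l// (ltn_trans rr').
apply/eqP; apply: contraT => vr; exfalso; apply: (ind r) => //.
exists (fun t => if insub t is Some r' then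
  - (v 0 r)^-1 * v 0 (r' : 'I_n) else 0) => k b.
have := congr1 (fun M : 'rV[R]_m => M 0 b) (hv k).
rewrite !mxE (bigD1 r)//= mxE => /eqP; rewrite addr_eq0 => /eqP h.
rewrite -[LHS](mulKf vr) h mulrN -mulNr mulr_sumr.
rewrite (bigID (fun r' : 'I_n => (r' < r)%N)) /= [X in _ + X]big1 ?addr0; last first.
  move=> r' /andP[rr']; rewrite -leqNgt leq_eqVlt => /orP[/eqP e|/hgt ->].
    by move: rr'; rewrite -val_eqE /= e eqxx.
  by rewrite mul0r mulr0.
rewrite (big_ord_widen n (fun t => (if insub t is Some r' then
  - (v 0 r)^-1 * v 0 (r' : 'I_n) else 0) * flat_row s t k b)) ?(ltnW (ltn_ord r))//.
rewrite [RHS]big_mkcond [LHS]big_mkcond; apply: eq_bigr => r' _.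
rewrite valK mxE mulrA; case: ltnP => //.
  by move=> h'; rewrite -val_eqE /= ltn_eqF.
by rewrite andbF.
Qed.

(** Each of the rows [n + c] depends on the previous ones; by induction on [c],
    those of index at least [n] can be eliminated. *)
Lemma dependent_rows s :
  (forall c : 'I_m, dependent s (n + c)) ->
  exists A : 'M[R]_(m, n), forall (c : 'I_m) k b,
    flat_row s (n + c) k b = \sum_(r < n) A c r * flat_row s r k b.
Proof.
move=> dep.
suff h c : (c < m)%N -> exists w : 'rV[R]_n, forall k b,
    flat_row s (n + c) k b = \sum_(r < n) w 0 r * flat_row s r k b.
  have /choice[w hw] : forall c : 'I_m, exists w : 'rV[R]_n, forall k b,
    flat_row s (n + c) k b = \sum_(r < n) w 0 r * flat_row s r k b.
    by move=> c; exact: h.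
  exists (\matrix_(c, r) w c 0 r) => c k b; rewrite hw.
  by apply: eq_bigr => r _; rewrite mxE.
elim/ltn_ind: c => c IH cm.
have /choice[w hw] : forall c', exists w : 'rV[R]_n, (c' < c)%N -> forall k b,
    flat_row s (n + c') k b = \sum_(r < n) w 0 r * flat_row s r k b.
  move=> c'; case: (ltnP c' c) => h; last by exists 0.
  by have [w hw] := IH _ h (ltn_trans h cm); exists w.
have [a ha] := dep (Ordinal cm).
exists (\row_r (a r + \sum_(c' < c) a (n + c')%N * w c' 0 r)) => k b.
rewrite [LHS]ha /= big_split_ord /=.
under [X in _ + X = _]eq_bigr do rewrite hw// mulr_sumr.
rewrite exchange_big -big_split /=; apply: eq_bigr => r _.
rewrite mxE mulrDl mulr_suml; congr (_ + _).
by apply: eq_bigr => c' _; rewrite mulrA.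
Qed.

(** Acting on the left, it moves all rows up by [m] and puts at the bottom the
    combinations of rows prescribed by [A]. *)
Definition companion (A : 'M[R]_(m, n)) : 'M[R]_n := \matrix_(r, r')
  if (r + m < n)%N then (r' == (r + m)%N :> nat)%:R else A (ord_mod r) r'.

Lemma companion_shift (A : 'M[R]_(m, n)) q (B : 'M[R]_(n, q)) (r r' : 'I_n) b :
  r' = (r + m)%N :> nat -> (companion A *m B) r b = B r' b.
Proof.
move=> e; rewrite mxE (bigD1 r')//= mxE -e ltn_ord eqxx mul1r big1 ?addr0// => j jr.
by rewrite mxE -e ltn_ord val_eqE (negbTE jr) mul0r.
Qed.

Lemma companion_last (A : 'M[R]_(m, n)) q (B : 'M[R]_(n, q)) (r : 'I_n) b :
  (n <= r + m)%N -> (companion A *m B) r b = (A *m B) (ord_mod r) b.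
Proof.
move=> e; rewrite !mxE; apply: eq_bigr => j _.
by rewrite mxE ltnNge e.
Qed.

Definition output : 'M[R]_(m, n) := \matrix_(c, r) (r == c :> nat)%:R.

Lemma output_mul q (B : 'M[R]_(n, q)) (c : 'I_m) (r : 'I_n) b :
  r = c :> nat -> (output *m B) c b = B r b.
Proof.
move=> e; rewrite mxE (bigD1 r)//= mxE e eqxx mul1r big1 ?addr0// => j jr.
by rewrite mxE -e val_eqE (negbTE jr) mul0r.
Qed.

Lemma last_row_mod (r : 'I_n) : (n <= r + m)%N -> (r + m)%N = (n + ord_mod r)%N.
Proof.
move=> h; rewrite /= {1}(divn_eq r m) addnAC; congr (_ + _)%N.
have rp : (r %/ m < p)%N by rewrite ltn_divLR.
have pr : (p <= r %/ m + 1)%N.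
  have : (p <= (r + m) %/ m)%N by rewrite leq_divRL.
  by rewrite divnDr// divnn hm.
by rewrite -mulSnr; congr (_ * _)%N; lia.
Qed.

Lemma hankel_stateS s (A : 'M[R]_(m, n)) :
  (forall (c : 'I_m) k b,
    flat_row s (n + c) k b = \sum_(r < n) A c r * flat_row s r k b) <->
  (forall k, hankel_state s k.+1 = companion A *m hankel_state s k).
Proof.
have eqA c k b : (A *m hankel_state s k) c b = \sum_(r < n) A c r * flat_row s r k b.
  by rewrite mxE; apply: eq_bigr => r _; rewrite mxE.
split=> h => [k|c k b].
  apply/matrixP => r b; rewrite mxE -flat_rowD.
  have [lt|ge] := ltnP (r + m) n.
    by rewrite (@companion_shift _ _ _ _ (Ordinal lt))// mxE.
  by rewrite companion_last// eqA -h last_row_mod.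
have lt : (p.-1 * m + c < n)%N by rewrite -{2}(prednK hp) mulSnr ltn_add2l.
have en : (n + c = p.-1 * m + c + m)%N by rewrite -{1}(prednK hp) mulSnr addnAC.
have := congr1 (fun M : 'M[R]_(n, m) => M (Ordinal lt) b) (h k).
rewrite companion_last ?eqA /=; last by rewrite -en leq_addr.
rewrite mxE en flat_rowD => ->; apply: eq_bigr => r _; congr (A _ _ * _).
by apply: val_inj; rewrite /= modnMDl modn_small.
Qed.

End state.
End hankel.

(** * Realization of the systems of the generic class *)

Section l2_coordinates.
Variables (R : realType) (m : nat).

Lemma sqr_entry_le_mxdot (A : 'M[R]_m) i j : A i j ^+ 2 <= mxdot A A.
Proof.
rewrite mxdotE (bigD1 i)//= (bigD1 j)//= expr2 -addrA lerDl addr_ge0//.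
  by apply: sumr_ge0 => ? _; rewrite -expr2 sqr_ge0.
by apply: sumr_ge0 => ? _; apply: sumr_ge0 => ? _; rewrite -expr2 sqr_ge0.
Qed.

Lemma ler_entry_l2norm (s : l2mx R m) k i j : `|s k i j| <= `|s|.
Proof.
have -> : `|s| = l2norm s by [].
rewrite -sqrtr_sqr /l2norm ler_wsqrtr//; apply: le_trans (mxdot_le_l2dot s k).
exact: sqr_entry_le_mxdot.
Qed.

Lemma cvg_l2_entry {T : Type} {F : set_system T} {FF : Filter F}
    (g : T -> l2mx R m) (g0 : l2mx R m) k i j :
  g @ F --> g0 -> (fun t => g t k i j) @ F --> g0 k i j.
Proof.
move=> /cvgrPdist_lt h; apply/cvgrPdist_lt => e /h; apply: filterS => t.
apply: le_lt_trans.
have -> : g0 k i j - g t k i j = (g0 - g t) k i j.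
  by rewrite -[RHS]/((g0 k - g t k) i j) !mxE.
exact: ler_entry_l2norm.
Qed.

Lemma l2_entry_cvg0 (s : l2mx R m) i j : (fun k => s k i j) @ \oo --> (0 : R).
Proof.
apply/cvgr0Pnorm_lt => e e0.
have /cvg_series_cvg_0 /cvgr0Pnorm_lt : cvgn (dot_series s s) by exact: is_cvg_l2dot.
move=> /(_ (e ^+ 2)); rewrite exprn_gt0// => /(_ isT); apply: filterS => k /=.
move=> /(le_lt_trans (ler_norm _)) h.
have : `|s k i j| ^+ 2 < e ^+ 2.
  by apply: le_lt_trans h; rewrite real_normK ?num_real// sqr_entry_le_mxdot.
by rewrite ltr_pXn2r// nnegrE ltW.
Qed.

End l2_coordinates.

Section realization.
Variables (R : realType) (m p : nat).
Hypotheses (hm : (0 < m)%N) (hp : (0 < p)%N).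
Local Notation n := (p * m)%N.
Implicit Types (A : 'M[R]_(m, n)) (X : 'M[R]_(n, m)) (s : l2mx R m).

Local Notation companion := (@companion R m hm p).
Local Notation output := (@output R m p).
Local Notation hankel_state := (@hankel_state R m hm p).

(** The transition matrix with the blocks [0], [output], [0], [companion A]
    delays the sequence [output *m companion A ^+ k *m X] by one step and puts
    the identity in front of it, so that the whole system, with [H_0 = 1], is
    a single response. *)
Definition markov A X : l2mx R m :=
  response (row_mx 1%:M 0) (block_mx 0 output 0 (companion A)) (col_mx 1%:M X).

Definition admissible A X : Prop :=
  stable (companion A) /\ gram (companion A) X \in unitmx.

Lemma stable_markov A : stable (companion A) ->
  stable (block_mx 0 output 0 (companion A)).
Proof.
by apply: stable_block_trig; exists 1%N; rewrite expr1 normr0 mulr0.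
Qed.

Lemma markov0 A X : stable (companion A) -> markov A X 0%N = 1%:M.
Proof.
move=> /stable_markov sA; rewrite responseE// expr0 mulmx1 mul_row_col.
by rewrite mul1mx mul0mx addr0.
Qed.

Lemma markovS A X k : stable (companion A) ->
  markov A X k.+1 = output *m (companion A ^+ k *m X).
Proof.
move=> /stable_markov sA; rewrite responseE// exp_block_trig mul_row_block.
have exp0 j : (0 : 'M[R]_m) ^+ j.+1 = 0 by rewrite exprS mul0r.
rewrite mul_row_col exp0 !(mul0mx, mulmx0, mul1mx) addr0.
have -> : (0 : 'M[R]_m) *m (1%:M : 'M[R]_m) = 0 by exact: mul0mx.
rewrite addr0 add0r.
rewrite big_ord_recl /= expr0 mul1mx subn0 big1 ?addr0 ?mulmxA// => i _.
by rewrite exp0 !mul0mx.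
Qed.

(** Observability: the rows of the state are successive outputs. *)
Lemma companion_exp A q (B : 'M[R]_(n, q)) j (r0 r : 'I_n) b :
  r = (j * m + r0)%N :> nat -> (companion A ^+ j *m B) r0 b = B r b.
Proof.
elim: j B r => [|j IH] B r e.
  by rewrite expr0 mul1mx; congr (B _ _); apply: val_inj.
have lt : (j * m + r0 < n)%N.
  by apply: leq_trans (ltn_ord r); rewrite e ltnS mulSn -addnA leq_addl.
rewrite -mulmx_exprSr -mulmxA (IH _ (Ordinal lt))//.
by apply: companion_shift; rewrite e /= mulSnr addnAC.
Qed.

Lemma hankel_state_markov A X k : stable (companion A) ->
  hankel_state (markov A X) k = companion A ^+ k *m X.
Proof.
move=> sA; apply/matrixP => r b; rewrite mxE /flat_row markovS//.
have lt : (r %% m < n)%N by rewrite (leq_ltn_trans (leq_mod _ _)).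
rewrite (@output_mul _ _ _ _ _ _ (Ordinal lt))// exprD -mulmxA.
by apply: companion_exp; rewrite /= -divn_eq.
Qed.

Lemma dependentMD s j t : dependent hm s t -> dependent hm s (j * m + t).
Proof.
move=> h; elim: j => [|j IH] //.
by rewrite mulSnr addnAC; exact: dependentD.
Qed.

(** The first [n] rows are independent since the Gram matrix is invertible;
    the rows below depend on them by the recursion, and shifting it gives all
    the others. *)
Lemma markov_kronecker A X : admissible A X ->
  forall c, has_kronecker_index (markov A X) c p.
Proof.
move=> [sA /unitmx_gram uG] c; apply/(kronecker_indexP hm) => i.
rewrite (retained_flat hm); split=> [nd|ip [a ha]].
  rewrite ltnNge; apply/negP => pi; apply: nd.
  rewrite -(subnK pi) mulnDl -addnA; apply: dependentMD.
  have hrec : forall k, hankel_state (markov A X) k.+1 =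
      companion A *m hankel_state (markov A X) k.
    by move=> k; rewrite !hankel_state_markov// mulmxA mulmx_exprS.
  move/(hankel_stateS hm hp) : hrec => hrec.
  exists (fun t => if insub t is Some r then A c r else 0) => k b.
  rewrite hrec big_split_ord /= [X in _ = _ + X]big1 ?addr0.
    by apply: eq_bigr => r _; rewrite valK.
  by move=> r _; rewrite insubN ?mul0r// -leqNgt leq_addr.
have lt : (i * m + c < n)%N.
  apply: (@leq_trans (i.+1 * m)); first by rewrite mulSnr ltn_add2l.
  by rewrite leq_mul2r ip orbT.
pose v : 'rV[R]_n := \row_r
  ((r == Ordinal lt)%:R - (if (r < i * m + c)%N then a r else 0)).
have : v 0 (Ordinal lt) = 0.
  suff -> : v = 0 by rewrite mxE.
  apply: uG => k; rewrite -hankel_state_markov//; apply/rowP => b; rewrite !mxE.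
  under eq_bigr do rewrite !mxE mulrBl.
  rewrite sumrB (bigD1 (Ordinal lt))//= eqxx mul1r ha.
  rewrite [X in _ + X - _]big1 ?addr0; last first.
    by move=> r /negbTE ->; rewrite mul0r.
  rewrite (big_ord_widen n (fun t => a t * flat_row hm (markov A X) t k b) (ltnW lt)).
  rewrite big_mkcond; apply/eqP; rewrite subr_eq0; apply/eqP/eq_bigr => r _.
  by case: ifP; rewrite ?mul0r.
by rewrite !mxE eqxx ltnn subr0 => /eqP; rewrite oner_eq0.
Qed.

Lemma markov_rational A X : stable (companion A) -> rational_transfer (markov A X).
Proof.
move=> sA a b; have [d d0 hd] := annihilating_poly (companion A).
exists (\poly_(j < size d) \sum_(j <= k < size d) d`_k * markov A X (k - j)%N a b), d.
split=> // [j|i].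
  by rewrite coef_poly; case: ltnP => // h; rewrite big_geq.
transitivity ((output *m ((\sum_(k < size d) d`_k *: companion A ^+ k) *m
    (companion A ^+ i *m X))) a b); last by rewrite hd mul0mx mulmx0 mxE.
rewrite mulmx_suml mulmx_sumr summxE; apply: eq_bigr => k _.
rewrite addnS markovS// -scalemxAl -scalemxAr mulmxA.
by rewrite exprD mulmxA [RHS]mxE !mulmxA.
Qed.

Lemma markov_generic A X : admissible A X -> @generic_class R m p (markov A X).
Proof.
move=> adm; have [sA _] := adm; split; last exact: markov_kronecker.
split; [exact: markov0|exact: markov_rational|].
move=> z [a [b [num [den [hf cop rz]]]]].
rewrite real_ltNge ?normr_real ?real1//; apply/negP => z1.
have rn := fraction_pole (l2_entry_cvg0 (markov A X) a b) hf rz z1.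
have : coprimep (map_poly (real_complex R) num) (map_poly (real_complex R) den).
  by rewrite coprimep_map.
by move=> /coprimep_root /(_ rn); rewrite (rootP rz) eqxx.
Qed.

Lemma generic_markov s : @generic_class R m p s ->
  exists A X, admissible A X /\ s = markov A X.
Proof.
move=> [[s0 _ _] kr].
have ret i (c : 'I_m) : ~ dependent hm s (i * m + c) <-> (i < p)%N.
  have K := (kronecker_indexP hm s c p).1 (kr c) i.
  by split=> [/(retained_flat hm)/K|/K/(retained_flat hm)].
have ind t : (t < n)%N -> ~ dependent hm s t.
  move=> tn; rewrite (divn_eq t m); apply: (ret _ (ord_mod hm t)).2.
  by rewrite ltn_divLR.
have [A hA] : exists A, forall (c : 'I_m) k b,
    flat_row hm s (n + c) k b = \sum_(r < n) A c r * flat_row hm s r k b.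
  apply: dependent_rows => c; apply: contrapT => /ret.
  by rewrite ltnn.
move/(hankel_stateS hm hp) : hA => hA.
pose X := hankel_state s 0%N.
have hX k : hankel_state s k = companion A ^+ k *m X.
  elim: k => [|k IH]; first by rewrite expr0 mul1mx.
  by rewrite hA IH mulmxA mulmx_exprS.
have uG : gram (companion A) X \in unitmx.
  apply/unitmx_gram => v hv; apply: (independent_rows ind) => k.
  by rewrite hX.
have sA : stable (companion A).
  apply: stable_krylov uG _; apply/cvg_mxP => r b; rewrite mxE.
  under eq_fun do rewrite -hX mxE /flat_row.
  under eq_fun do rewrite -addnS addnC addSnnS.
  exact: (cvg_comp _ _ (@cvg_addnr _) (l2_entry_cvg0 s (ord_mod hm r) b)).
exists A, X; split=> //; apply: val_inj; apply/funext => -[|k].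
  by rewrite -[RHS]/(markov A X 0%N) markov0.
rewrite -[RHS]/(markov A X k.+1) markovS// -hX; apply/matrixP => c b.
have lt : (c < n)%N by rewrite (leq_trans (ltn_ord c))// -{1}[m]mul1n leq_mul2r hp orbT.
rewrite (@output_mul _ _ _ _ _ _ (Ordinal lt))// mxE /flat_row /=.
rewrite divn_small// add0n; congr (s _ _ _).
by apply: val_inj; rewrite /= modn_small.
Qed.

End realization.

(** * The global chart *)

Section chart.
Variables (R : realType) (m p : nat).
Hypotheses (hm : (0 < m)%N) (hp : (0 < p)%N).
Local Notation n := (p * m)%N.
Local Notation d := (2 * p * m ^ 2)%N.
Local Notation companion := (@companion R m hm p).
Local Notation output := (@output R m p).
Local Notation hankel_state := (@hankel_state R m hm p).
Local Notation markov := (@markov R m p hm).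
Local Notation admissible := (@admissible R m p hm).
Implicit Types (A : 'M[R]_(m, n)) (X : 'M[R]_(n, m)) (s : l2mx R m).

Lemma dim_split : d = (m * n + n * m)%N.
Proof. by rewrite expnS expn1; lia. Qed.

Definition split_coord (x : 'rV[R]_d) : 'rV[R]_(m * n + n * m) :=
  castmx (erefl, dim_split) x.

Definition ar_coef (x : 'rV[R]_d) : 'M[R]_(m, n) := vec_mx (lsubmx (split_coord x)).

Definition init_state (x : 'rV[R]_d) : 'M[R]_(n, m) := vec_mx (rsubmx (split_coord x)).

Definition join_coord A X : 'rV[R]_d :=
  castmx (erefl, esym dim_split) (row_mx (mxvec A) (mxvec X)).

Lemma ar_coef_join A X : ar_coef (join_coord A X) = A.
Proof. by rewrite /ar_coef /split_coord castmxKV row_mxKl mxvecK. Qed.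

Lemma init_state_join A X : init_state (join_coord A X) = X.
Proof. by rewrite /init_state /split_coord castmxKV row_mxKr mxvecK. Qed.

Lemma join_coordK x : join_coord (ar_coef x) (init_state x) = x.
Proof.
by rewrite /join_coord !vec_mxK hsubmxK; exact: (castmxK (erefl _) dim_split).
Qed.

Lemma ar_coef_affine (y w : 'rV[R]_d) t :
  ar_coef (t *: w + y) = ar_coef y + t *: ar_coef w.
Proof. by apply/matrixP => i j; rewrite !(mxE, castmxE) addrC. Qed.

Lemma init_state_affine (y w : 'rV[R]_d) t :
  init_state (t *: w + y) = init_state y + t *: init_state w.
Proof. by apply/matrixP => i j; rewrite !(mxE, castmxE) addrC. Qed.

Lemma continuous_ar_coef : continuous ar_coef.
Proof.
move=> x; apply: (cvg_mxP (F := nbhs x) ar_coef (ar_coef x)).2 => i j.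
rewrite !(mxE, castmxE).
under eq_fun do rewrite !(mxE, castmxE).
exact: coord_continuous.
Qed.

Lemma continuous_init_state : continuous init_state.
Proof.
move=> x; apply: (cvg_mxP (F := nbhs x) init_state (init_state x)).2 => i j.
rewrite !(mxE, castmxE).
under eq_fun do rewrite !(mxE, castmxE).
exact: coord_continuous.
Qed.

Lemma cvg_join_coord {T : Type} {F : set_system T} {FF : Filter F}
    (f : T -> 'M[R]_(m, n)) (g : T -> 'M[R]_(n, m)) A X :
  f @ F --> A -> g @ F --> X ->
  (fun t => join_coord (f t) (g t)) @ F --> join_coord A X.
Proof.
move=> fA gX.
have cf : (fun t => mxvec (f t)) @ F --> mxvec A.
  apply/cvg_mxP => i j; rewrite ord1; case/mxvec_indexP: j => k l.
  rewrite mxvecE; under eq_fun do rewrite mxvecE.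
  exact: (cvg_mxP f A).1.
have cg : (fun t => mxvec (g t)) @ F --> mxvec X.
  apply/cvg_mxP => i j; rewrite ord1; case/mxvec_indexP: j => k l.
  rewrite mxvecE; under eq_fun do rewrite mxvecE.
  exact: (cvg_mxP g X).1.
have /cvg_mxP h : (fun t => row_mx (mxvec (f t)) (mxvec (g t))) @ F -->
    row_mx (mxvec A) (mxvec X) by exact: cvg_row_mx.
apply/cvg_mxP => i j; rewrite castmxE.
by under eq_fun do rewrite castmxE; exact: h.
Qed.

(** The linear part of the affine map [companion]. *)
Definition companion_dir A : 'M[R]_n := \matrix_(r, r')
  if (r + m < n)%N then 0 else A (ord_mod hm r) r'.

Lemma companion_affine A A' t :
  companion (A + t *: A') = companion A + t *: companion_dir A'.
Proof.
apply/matrixP => r r'; rewrite !mxE; case: ifP => _; first by rewrite mulr0 addr0.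
by [].
Qed.

Definition last_row (c : 'I_m) : nat := (p.-1 * m + c)%N.

Lemma last_row_ltn c : (last_row c < n)%N.
Proof. by rewrite /last_row -{2}(prednK hp) mulSnr ltn_add2l. Qed.

(** A left inverse of [companion] that is defined on all matrices. *)
Definition bottom (B : 'M[R]_n) : 'M[R]_(m, n) :=
  \matrix_(c, r) B (Ordinal (last_row_ltn c)) r.

Lemma last_row_shift c : (last_row c + m < n)%N = false.
Proof. by rewrite /last_row addnAC -mulSnr prednK// ltnNge leq_addr. Qed.

Lemma ord_mod_last_row c : ord_mod hm (last_row c) = c.
Proof. by apply: val_inj; rewrite /= modnMDl modn_small. Qed.

Lemma bottom_companion A : bottom (companion A) = A.
Proof. by apply/matrixP => c r; rewrite !mxE last_row_shift ord_mod_last_row. Qed.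

Lemma bottom_companion_dir A : bottom (companion_dir A) = A.
Proof. by apply/matrixP => c r; rewrite !mxE last_row_shift ord_mod_last_row. Qed.

Lemma cvg_companion {T : Type} {F : set_system T} {FF : Filter F}
    (f : T -> 'M[R]_(m, n)) A :
  f @ F --> A -> (fun t => companion (f t)) @ F --> companion A.
Proof.
move=> /cvg_mxP fA; apply/cvg_mxP => r r'; rewrite mxE.
under eq_fun do rewrite mxE.
by case: ifP => _; [exact: cvg_cst|exact: fA].
Qed.

Lemma cvg_hankel_state {T : Type} {F : set_system T} {FF : Filter F}
    (g : T -> l2mx R m) (g0 : l2mx R m) k :
  g @ F --> g0 -> (fun t => hankel_state (g t) k) @ F --> hankel_state g0 k.
Proof.
move=> gF; apply/cvg_mxP => r b; rewrite mxE.
by under eq_fun do rewrite mxE; exact: cvg_l2_entry.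
Qed.

Definition system_gram s : 'M[R]_n :=
  \sum_(k < n) hankel_state s k *m (hankel_state s k)^T.

Definition system_shift s : 'M[R]_n :=
  (\sum_(k < n) hankel_state s k.+1 *m (hankel_state s k)^T) *m
  invmx (system_gram s).

Definition system_coord s : 'rV[R]_d :=
  join_coord (bottom (system_shift s)) (hankel_state s 0%N).

Definition system_chart : chart (l2mx R m) d := Chart
  [set x | admissible (ar_coef x) (init_state x)]
  (fun x => markov (ar_coef x) (init_state x)) system_coord.

Local Notation D := (chart_domain system_chart).
Local Notation Phi := (chart_param system_chart).

Lemma system_gram_markov A X : stable (companion A) ->
  system_gram (markov A X) = gram (companion A) X.
Proof. by move=> sA; apply: eq_bigr => k _; rewrite hankel_state_markov. Qed.

Lemma system_coordK x : D x -> system_coord (Phi x) = x.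
Proof.
move=> [sA uG]; rewrite /system_coord -[RHS]join_coordK; congr join_coord; last first.
  by rewrite hankel_state_markov// expr0 mul1mx.
rewrite -[RHS]bottom_companion [in RHS](gram_shift uG).
rewrite /system_shift system_gram_markov//.
congr (bottom (_ *m _)); apply: eq_bigr => k _.
by rewrite !hankel_state_markov.
Qed.

Lemma cvg_system_coord {T : Type} {F : set_system T} {FF : Filter F}
    (g : T -> l2mx R m) (g0 : l2mx R m) : system_gram g0 \in unitmx ->
  g @ F --> g0 -> (fun t => system_coord (g t)) @ F --> system_coord g0.
Proof.
move=> uG gF; have cH k : (fun t => hankel_state (g t) k) @ F --> hankel_state g0 k.
  exact: cvg_hankel_state.
have cG : (fun t => system_gram (g t)) @ F --> system_gram g0.
  by apply: cvg_sumr => k _; apply: cvg_mulmx => //; exact: cvg_trmx.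
apply: cvg_join_coord => //.
have /cvg_mxP h : (fun t => system_shift (g t)) @ F --> system_shift g0.
  apply: cvg_mulmx; last exact: cvg_invmx.
  by apply: cvg_sumr => k _; apply: cvg_mulmx => //; exact: cvg_trmx.
apply/cvg_mxP => c r; rewrite mxE.
by under eq_fun do rewrite mxE; exact: h.
Qed.

Lemma cvg_gram {T : Type} {F : set_system T} {FF : Filter F}
    (f : T -> 'M[R]_n) (g : T -> 'M[R]_(n, m)) (A : 'M[R]_n) X :
  f @ F --> A -> g @ F --> X -> (fun t => gram (f t) (g t)) @ F --> gram A X.
Proof.
move=> fA gX; apply: cvg_sumr => k _.
have cX : (fun t => f t ^+ k *m g t) @ F --> A ^+ k *m X.
  by apply: cvg_mulmx => //; exact: cvg_expmx.
by apply: cvg_mulmx => //; exact: cvg_trmx.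
Qed.

Lemma open_domain : open D.
Proof.
rewrite openE => x [sA uG].
have cA : (fun y => companion (ar_coef y)) @ x --> companion (ar_coef x).
  exact: (cvg_companion (F := nbhs x) (@continuous_ar_coef x)).
have cG : (fun y => gram (companion (ar_coef y)) (init_state y)) @ x -->
    gram (companion (ar_coef x)) (init_state x).
  exact: (cvg_gram (F := nbhs x) cA (@continuous_init_state x)).
have h1 : \forall y \near x, stable (companion (ar_coef y)).
  exact: (near_stable cA sA).
have h2 : \forall y \near x, gram (companion (ar_coef y)) (init_state y) \in unitmx.
  exact: (near_unitmx cG uG).
by apply: filterS2 h1 h2 => y; split.
Qed.

Lemma image_domain : Phi @` D = @generic_class R m p.
Proof.
apply/seteqP; split=> [_ [x adm <-]|s /(generic_markov hm hp)[A [X [adm ->]]]].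
  exact: markov_generic.
by exists (join_coord A X); rewrite /= ar_coef_join init_state_join.
Qed.

Lemma smooth_param : smooth_on D Phi.
Proof.
apply: (@smooth_on_response R m _ _ open_domain _ _
  (fun x => block_mx 0 output 0 (companion (ar_coef x)))
  (fun w => block_mx 0 0 0 (companion_dir (ar_coef w)))
  (fun x => col_mx 1%:M (init_state x)) (fun w => col_mx 0 (init_state w))).
- move=> x; apply: (cvg_col_mx (F := nbhs x)); apply: (cvg_row_mx (F := nbhs x));
    try exact: cvg_cst.
  exact: (cvg_companion (F := nbhs x) (@continuous_ar_coef x)).
- by move=> x; apply: (cvg_col_mx (F := nbhs x));
    [exact: cvg_cst|exact: continuous_init_state].
- move=> y w t; rewrite scale_block_mx add_block_mx !scaler0 !addr0.
  by rewrite ar_coef_affine companion_affine.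
- by move=> y w t; rewrite scale_col_mx add_col_mx scaler0 addr0 init_state_affine.
- by move=> y [sA _]; exact: stable_markov.
Qed.

(** The difference quotient of the identity [Y1 = B *m Y0] when [B] has
    the increment [h *: V]. *)
Lemma quotient_shift (B V : 'M[R]_n) (Y0 Y0' Y1 Y1' : 'M[R]_(n, m)) (h : R) :
  h != 0 -> Y1' = B *m Y0' + h *: (V *m Y0') -> Y1 = B *m Y0 ->
  h^-1 *: (Y1' - Y1) - B *m (h^-1 *: (Y0' - Y0)) = V *m Y0'.
Proof.
move=> h0 -> ->; rewrite -scalemxAr -scalerBr mulmxBr opprB.
rewrite addrA subrK addrAC subrr add0r.
by rewrite scalerA mulVf// scale1r.
Qed.

Lemma hankel_stateZB s s' (h : R) k :
  hankel_state (h *: (s - s')) k = h *: (hankel_state s k - hankel_state s' k).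
Proof.
apply/matrixP => r b; rewrite !mxE.
by rewrite /flat_row -[LHS]/((h *: (s _ - s' _)) _ _) !mxE.
Qed.

Lemma hankel_state_param x k : D x ->
  hankel_state (Phi x) k = companion (ar_coef x) ^+ k *m init_state x.
Proof. by move=> [sA _]; exact: hankel_state_markov. Qed.

Lemma hankel_state_param0 x : D x -> hankel_state (Phi x) 0%N = init_state x.
Proof. by move=> Dx; rewrite hankel_state_param// expr0 mul1mx. Qed.

Lemma hankel_state_paramS x k : D x ->
  hankel_state (Phi x) k.+1 = companion (ar_coef x) *m hankel_state (Phi x) k.
Proof. by move=> Dx; rewrite !hankel_state_param// mulmxA mulmx_exprS. Qed.

(** The difference quotients of [x |-> Phi x] in the direction [v] tend to 0,
    and so do those of all Hankel states. The identity between consecutive states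
    then forces the variation [V] of the companion matrix to annihilate
    all of them, hence to vanish. *)
Lemma param_immersion x v : D x -> 'D_v Phi x = 0 -> v = 0.
Proof.
move=> Dx Dv0; have [sA uG] := Dx.
set F := companion (ar_coef x); pose V := companion_dir (ar_coef v).
pose X h k := hankel_state (Phi (h *: v + x)) k.
pose q (h : R) := h^-1 *: (Phi (h *: v + x) - Phi x).
have q0 k : (fun h => hankel_state (q h) k) @ 0^' --> (0 : 'M[R]_(n, m)).
  have -> : (0 : 'M[R]_(n, m)) = hankel_state (0 : l2mx R m) k.
    by apply/matrixP => r b; rewrite !mxE /flat_row -[RHS]/((0 : 'M[R]_m) _ _) mxE.
  apply: cvg_hankel_state; rewrite -Dv0.
  have [_ /(_ v)[/(_ x Dx) dPhi _]] := smooth_param 1.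
  exact: dPhi.
have nearD : \forall h \near (0 : R)^', D (h *: v + x).
  exact: near_line open_domain Dx.
have VX k : V *m (F ^+ k *m init_state x) = 0.
  have lim1 : (fun h => V *m X h k) @ 0^' --> V *m (F ^+ k *m init_state x).
    apply: cvg_mulmx; first exact: cvg_cst.
    rewrite -(hankel_state_param k Dx); apply: cvg_hankel_state.
    have [cPhi _] := smooth_param 0.
    exact: (cvg_comp _ _ (@cvg_line _ _ x v) (cPhi x Dx)).
  have lim2 : (fun h => V *m X h k) @ 0^' --> (0 : 'M[R]_(n, m)).
    have : (fun h => hankel_state (q h) k.+1 - F *m hankel_state (q h) k) @ 0^' -->
        (0 : 'M[R]_(n, m)) - F *m (0 : 'M[R]_(n, m)).
      apply: cvgB; first exact: q0.
      by apply: cvg_mulmx; [exact: cvg_cst|exact: q0].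
    rewrite mulmx0 subr0; apply: cvg_trans; apply: near_eq_cvg; near=> h.
    have Dh : D (h *: v + x) by near: h.
    have h0 : h != 0 by near: h; exact: nbhs_dnbhs_neq.
    have e1 : X h k.+1 = F *m X h k + h *: (V *m X h k).
      rewrite /X (hankel_state_paramS _ Dh) scalemxAl -mulmxDl.
      by rewrite /F /V -companion_affine -ar_coef_affine.
    have e2 : hankel_state (Phi x) k.+1 = F *m hankel_state (Phi x) k.
      exact: hankel_state_paramS.
    have qE j : hankel_state (q h) j = h^-1 *: (X h j - hankel_state (Phi x) j).
      exact: hankel_stateZB.
    suff : hankel_state (q h) k.+1 - F *m hankel_state (q h) k = V *m X h k by [].
    by rewrite !qE; exact: quotient_shift e1 e2.
  exact: (norm_cvg_unique lim1 lim2).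
have V0 : V = 0.
  rewrite -[V](mulmxK uG) /gram mulmx_sumr big1 ?mul0mx// => k _.
  by rewrite mulmxA VX mul0mx.
have W0 : init_state v = 0.
  have lim3 : (fun h => hankel_state (q h) 0%N) @ 0^' --> init_state v.
    have : (fun=> init_state v) @ (0 : R)^' --> init_state v by exact: cvg_cst.
    apply: cvg_trans; apply: near_eq_cvg; near=> h.
    have Dh : D (h *: v + x) by near: h.
    have h0 : h != 0 by near: h; exact: nbhs_dnbhs_neq.
    suff : hankel_state (q h) 0%N = init_state v by [].
    have e1 : X h 0%N = init_state x + h *: init_state v.
      by rewrite -init_state_affine; exact: hankel_state_param0.
    have e2 : hankel_state (Phi x) 0%N = init_state x by exact: hankel_state_param0.
    transitivity (h^-1 *: (X h 0%N - hankel_state (Phi x) 0%N)).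
      exact: hankel_stateZB.
    by rewrite e1 e2 addrAC subrr add0r scalerA mulVf// scale1r.
  exact: (norm_cvg_unique lim3 (q0 0%N)).
rewrite -[v]join_coordK W0 -[ar_coef v]bottom_companion_dir -/V V0.
rewrite (_ : bottom 0 = 0); last by apply/matrixP => c r; rewrite !mxE.
by rewrite /join_coord !linear0 row_mx0 castmx_const.
Unshelve. all: by end_near. Qed.

Lemma chart_generic : is_chart (@generic_class R m p) system_chart.
Proof.
split.
- exact: open_domain.
- by exists setT; [exact: openT|rewrite setIT image_domain].
- exact: system_coordK.
- apply: continuous_in_subspaceT => x /set_mem Dx.
  by have [cPhi _] := smooth_param 0; exact: cPhi.
- apply: continuous_in_subspaceT => s /set_mem[x Dx <-].
  apply: (cvg_system_coord (F := nbhs _) (g := id)); last exact: cvg_id.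
  by rewrite system_gram_markov; case: Dx.
Qed.

End chart.

Theorem theorem2 (R : realType) (m p : nat) (hm : (1 <= m)%N) (hp : (1 <= p)%N) :
  @differentiable_manifold R (l2mx R m) (2 * p * m ^ 2)%N (@generic_class R m p).
Proof.
exists [set system_chart R hm hp]; split.
- by move=> _ ->; exact: chart_generic.
- move=> s sM; exists (system_chart R hm hp) => //.
  by rewrite image_domain.
- move=> _ _ -> ->; rewrite /transition_smooth.
  rewrite (_ : [set x | _] = chart_domain (system_chart R hm hp)); last first.
    by apply/seteqP; split=> x [] // Dx; split=> //; exists x.
  move=> k; apply: (@Ck_on_eq R _ _ k _ id _ (@open_domain R m p hm hp)).
    by move=> x Dx; exact/esym/system_coordK.
  exact: smooth_on_id.
- move=> _ ->; split; first exact: smooth_param.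
  exact: param_immersion.
Qed.
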